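(* Let $d\in\{1,2,3\}$, $\Omega=(0,1)^d$, $\varepsilon>0$, and let $b:\Omega\to\mathbb{R}$ be a (measurable) function for which there are constants $b_0,b_1$ with $0<b_0<b(\vec{x})<b_1$ for every $\vec{x}\in\Omega$. Let $\beta$ be a (positive, $C^1$) weight function on $\Omega$ such that there exists $C>0$ for which $$\nabla\beta(\vec{x})\cdot\nabla\beta(\vec{x})<\frac{b_0\,\beta(\vec{x})^2}{\varepsilon(1+C)^2}\qquad\text{for every }\vec{x}\in\Omega,$$ and let $k\in\mathbb{R}$ be given. Let $a(\cdot,\cdot)$ be the weighted first-order system least-squares bilinear form and $|||\cdot|||_{\beta,k}$ the weighted product norm, both defined in the context. Then, for all $\mathcal{U},\mathcal{V}\in (H^1(\Omega))^{1+d}$, $$|a(\mathcal{U},\mathcal{V})|\le\left(3+2\max(b_0^{-1},b_1)\right)|||\mathcal{U}|||_{\beta,k}\,|||\mathcal{V}|||_{\beta,k}$$ and $$\min\left(\frac{C\min(1,b_0)}{1+C},\,b_1^{-1},\,1\right)|||\mathcal{U}|||_{\beta,k}^2\le a(\mathcal{U},\mathcal{U}).$$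
   Context: The setting is the reaction-diffusion problem $-\varepsilon\Delta u+bu=f$ on $\Omega$, $u|_{\partial\Omega}=0$, rewritten as a first-order system in $u$ and $\vec{w}=\nabla u$. Elements of $(H^1(\Omega))^{1+d}$ are written $\mathcal{U}=(u,\vec{w})^T$ and $\mathcal{V}=(v,\vec{z})^T$, with $u,v\in H^1(\Omega)$ scalar and $\vec{w},\vec{z}\in (H^1(\Omega))^d$ vector-valued, all real-valued. For a weight function $\beta$ on $\Omega$, the weighted inner product is $\langle u,v\rangle_\beta=\int_\Omega\beta(\vec{x})u(\vec{x})v(\vec{x})\,d\vec{x}$ for scalar functions, and $\langle\vec{w},\vec{z}\rangle_\beta=\int_\Omega\beta(\vec{x})\,\vec{w}(\vec{x})\cdot\vec{z}(\vec{x})\,d\vec{x}$ for vector functions; $\|\cdot\|_\beta$ is the associated norm. The first-order operator is $$\mathcal{L}\,\mathcal{U}=\begin{pmatrix}\varepsilon^{1/2}(\vec{w}-\nabla u)\\ -\varepsilon b^{-1/2}\nabla\cdot\vec{w}+b^{1/2}u\\ \varepsilon^{k/2}\nabla\times\vec{w}\end{pmatrix},$$ and the bilinear form is $a(\mathcal{U},\mathcal{V})=\langle\mathcal{L}\mathcal{U},\mathcal{L}\mathcal{V}\rangle_\beta$, i.e. $$a(\mathcal{U},\mathcal{V})=\varepsilon\langle\vec{w}-\nabla u,\vec{z}-\nabla v\rangle_\beta+\langle-\varepsilon b^{-1/2}\nabla\cdot\vec{w}+b^{1/2}u,\,-\varepsilon b^{-1/2}\nabla\cdot\vec{z}+b^{1/2}v\rangle_\beta+\varepsilon^k\langle\nabla\times\vec{w},\nabla\times\vec{z}\rangle_\beta.$$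 Here $\nabla\times$ is the usual curl if $d=3$, the scalar curl $\partial_{x_1}w_2-\partial_{x_2}w_1$ if $d=2$, and is absent (zero) if $d=1$. The weighted product norm is given by $$|||\mathcal{U}|||_{\beta,k}^2=\|u\|_\beta^2+\varepsilon\|\nabla u\|_\beta^2+\varepsilon\|\vec{w}\|_\beta^2+\varepsilon^2\|\nabla\cdot\vec{w}\|_\beta^2+\varepsilon^k\|\nabla\times\vec{w}\|_\beta^2.$$
   Formalization: The lower bound is proved only for U=(u,w) with u vanishing on the boundary (u in H^1_0), as in the underlying problem; for all of H^1 it is false (d=1, ε=b=β=1, u=w=e^x gives a(U,U)=0). ''Measurable'' is read as Borel measurable. *)

(* Defs.v *)
From HB Require Import structures.
From mathcomp Require Import all_boot all_order all_algebra.
From mathcomp Require Import all_classical all_reals all_analysis.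
Set Implicit Arguments.
Unset Strict Implicit.
Unset Printing Implicit Defensive.
Import Order.TTheory GRing.Theory Num.Theory.
Import numFieldNormedType.Exports.
Local Open Scope classical_set_scope.
Local Open Scope ring_scope.

Definition rV_display : measure_display.
Proof. exact. Qed.

(* The sigma-algebra on R^n generated by the coordinates, i.e. the Borel one. *)
Section measurable_rV.
Variables (R : realType) (n : nat).

Let coord (i : 'I_n) (x : 'rV[R]_n) : measurableTypeR R := x ord0 i.

Let rV_set0 : g_sigma_preimage coord set0.
Proof. exact: sigma_algebra0. Qed.

Let rV_setC A : g_sigma_preimage coord A -> g_sigma_preimage coord (~` A).
Proof. exact: sigma_algebraC. Qed.

Let rV_bigcup (F : (set 'rV[R]_n)^nat) :
  (forall i, g_sigma_preimage coord (F i)) ->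
  g_sigma_preimage coord (\bigcup_i (F i)).
Proof. exact: sigma_algebra_bigcup. Qed.

HB.instance Definition _ := @isMeasurable.Build rV_display
  'rV[R]_n (g_sigma_preimage coord) rV_set0 rV_setC rV_bigcup.

Lemma measurable_coord_rV (i : 'I_n) :
  measurable_fun [set: 'rV[R]_n] (fun x => x ord0 i : measurableTypeR R).
Proof.
move=> _ Y mY; rewrite setTI; apply: sub_sigma_algebra => /=.
rewrite -bigcup_seq/=; exists i => /=; first by rewrite mem_index_enum.
by exists Y => //; rewrite setTI.
Qed.

Lemma measurable_fun_rVP d (T : measurableType d) (f : T -> 'rV[R]_n) :
  (forall i, measurable_fun [set: T]
     (fun t => f t ord0 i : measurableTypeR R)) ->
  measurable_fun [set: T] f.
Proof.
move=> mf _ B mB; rewrite setTI.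
have : g_sigma_preimage (fun i (t : T) => f t ord0 i : measurableTypeR R)
    (f @^-1` B).
  have := g_sigma_preimage_comp coord f.
  move=> ->; exists B => //; exact: setTI.
have : g_sigma_preimage (fun i (t : T) => f t ord0 i : measurableTypeR R)
    `<=` measurable.
  apply: smallest_sub; first exact: sigma_algebra_measurable.
  rewrite -bigcup_seq/=; apply: bigcup_sub => i _.
  by move=> A [C mC <-]; exact: mf.
by move=> /[apply].
Qed.

End measurable_rV.

Section lebesgue_rV.
Variable R : realType.

Definition cons_rV n (p : measurableTypeR R * 'rV[R]_n) : 'rV[R]_n.+1 :=
  row_mx (const_mx p.1 : 'rV[R]_1) p.2.

Definition uncons_rV n (x : 'rV[R]_n.+1) : measurableTypeR R * 'rV[R]_n :=
  (x ord0 ord0, \row_i x ord0 (lift ord0 i)).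

Lemma cons_rV0 n (p : measurableTypeR R * 'rV[R]_n) :
  cons_rV p ord0 ord0 = p.1.
Proof.
by rewrite /cons_rV mxE; case: splitP => // j _; rewrite mxE.
Qed.

Lemma cons_rVS n (p : measurableTypeR R * 'rV[R]_n) (i : 'I_n) :
  cons_rV p ord0 (lift ord0 i) = p.2 ord0 i.
Proof.
rewrite /cons_rV mxE; case: splitP => [[[]//]|j /= ij].
by congr (p.2 _ _); apply/val_inj; move: ij; rewrite /bump/= => -[].
Qed.

Lemma cons_rVK n : cancel (@cons_rV n) (@uncons_rV n).
Proof.
move=> [a x]; rewrite /uncons_rV cons_rV0; congr pair.
by apply/rowP => i; rewrite mxE cons_rVS.
Qed.

Lemma uncons_rVK n : cancel (@uncons_rV n) (@cons_rV n).
Proof.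
move=> x; apply/rowP => i.
have [j ->|->] := unliftP ord0 i; first by rewrite cons_rVS mxE.
by rewrite cons_rV0.
Qed.

Lemma measurable_cons_rV n : measurable_fun [set: _] (@cons_rV n).
Proof.
apply: measurable_fun_rVP => i; have [j ->|->] := unliftP ord0 i.
- rewrite (_ : (fun _ => _) = (fun x : 'rV[R]_n => x ord0 j) \o snd); last first.
    by apply/funext => p /=; rewrite cons_rVS.
  exact: measurableT_comp (measurable_coord_rV j) measurable_snd.
- rewrite (_ : (fun _ => _) = fst); first exact: measurable_fst.
  by apply/funext => p; rewrite cons_rV0.
Qed.

Lemma measurable_uncons_rV n : measurable_fun [set: _] (@uncons_rV n).
Proof.
apply/measurable_fun_pair; first exact: measurable_coord_rV.
apply: measurable_fun_rVP => i.
rewrite (_ : (fun _ => _) = (fun x : 'rV[R]_n.+1 => x ord0 (lift ord0 i))).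
  exact: measurable_coord_rV.
by apply/funext => x; rewrite mxE.
Qed.

Section cons_measure.
Variables (n : nat) (m : {sigma_finite_measure set 'rV[R]_n -> \bar R}).

Definition cons_measure : set 'rV[R]_n.+1 -> \bar R :=
  pushforward (lebesgue_measure \x m)%E (@cons_rV n).

Let cons_measure0 : cons_measure set0 = 0%E.
Proof. by rewrite /cons_measure /pushforward preimage_set0 measure0. Qed.

Let cons_measure_ge0 A : (0 <= cons_measure A)%E.
Proof. exact: (measure_ge0 (lebesgue_measure \x m)%E). Qed.

Let cons_measure_sigma_additive : semi_sigma_additive cons_measure.
Proof.
move=> F mF tF mUF; rewrite /cons_measure /pushforward preimage_bigcup.
have mpre A : measurable A -> measurable (@cons_rV n @^-1` A).
  by move=> mA; rewrite -[X in measurable X]setTI; exact: measurable_cons_rV.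
apply: measure_semi_sigma_additive.
- by move=> k; exact: mpre.
- apply/trivIsetP => i j _ _ ij; rewrite -preimage_setI.
  by move/trivIsetP : tF => /(_ _ _ _ _ ij) ->//; rewrite preimage_set0.
- by rewrite -preimage_bigcup; exact: mpre.
Qed.

HB.instance Definition _ := isMeasure.Build _ _ _ cons_measure
  cons_measure0 cons_measure_ge0 cons_measure_sigma_additive.

Let cons_measure_sigma_finite : sigma_finite setT cons_measure.
Proof.
have /sigma_finiteP[F [TF ndF Foo]] := sigma_finiteT (@lebesgue_measure R).
have /sigma_finiteP[G [TG ndG Goo]] := sigma_finiteT m.
exists (fun k => @uncons_rV n @^-1` (F k `*` G k)).
  rewrite -preimage_bigcup; apply/esym; rewrite -subTset => x _ /=.
  case: (uncons_rV x) => a y.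
  have [k _ Fka] : (\bigcup_k F k) a by rewrite -TF.
  have [l _ Gly] : (\bigcup_k G k) y by rewrite -TG.
  exists (maxn k l) => //; split => /=.
  - by move: a Fka; exact/subsetPset/ndF/leq_maxl.
  - by move: y Gly; exact/subsetPset/ndG/leq_maxr.
move=> k; have [mFk Fkoo] := Foo k; have [mGk Gkoo] := Goo k; split.
  rewrite -[X in measurable X]setTI.
  by apply: measurable_uncons_rV => //; exact: measurableX.
rewrite /cons_measure /pushforward -comp_preimage.
rewrite (_ : _ \o _ = id); last by apply/funext => p; exact: cons_rVK.
rewrite preimage_id product_measure1E// lte_mul_pinfty//.
by rewrite ge0_fin_numE.
Qed.

HB.instance Definition _ := Measure_isSigmaFinite.Build _ _ _ cons_measure
  cons_measure_sigma_finite.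

End cons_measure.

(* Lebesgue measure on R^n, as the n-fold product of Lebesgue measure on R. *)
Fixpoint lebesgue_rV n : {sigma_finite_measure set 'rV[R]_n -> \bar R} :=
  if n is n'.+1 then cons_measure (lebesgue_rV n')
  else dirac (0 : 'rV[R]_0).

End lebesgue_rV.

Section sobolev.
Variables (R : realType) (d : nat).
Implicit Types (f u g phi : 'rV[R]_d -> R) (w : 'rV[R]_d -> 'rV[R]_d).

Definition Omega : set 'rV[R]_d := [set x | forall i, 0 < x ord0 i < 1].

Definition partial (i : 'I_d) f : 'rV[R]_d -> R :=
  fun x => 'D_(delta_mx ord0 i) f x.

Definition gradient f : 'rV[R]_d -> 'rV[R]_d :=
  fun x => \row_i partial i f x.

Fixpoint Ck (k : nat) f : Prop :=
  (forall x, Omega x -> {for x, continuous f}) /\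
  if k is k'.+1 then
    forall i, (forall x, Omega x -> derivable f x (delta_mx ord0 i)) /\
              Ck k' (partial i f)
  else True.

(* C_c^oo(Omega), extended by 0 outside Omega. *)
Definition test_function phi : Prop :=
  (forall k, Ck k phi) /\
  exists K : set 'rV[R]_d,
    [/\ compact K, K `<=` Omega & forall x, ~ K x -> phi x = 0].

Definition L2 u : Prop :=
  measurable_fun Omega u /\
  (lebesgue_rV R d).-integrable Omega (fun x => (u x ^+ 2)%:E).

Definition is_weak_partial (i : 'I_d) u g : Prop :=
  forall phi, test_function phi ->
    \int[lebesgue_rV R d]_(x in Omega) (u x * partial i phi x) =
    - \int[lebesgue_rV R d]_(x in Omega) (g x * phi x).

Definition H1 u : Prop :=
  L2 u /\ forall i, exists g, L2 g /\ is_weak_partial i u g.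

(* A representative of the weak derivative (unique up to null sets); the value
   is only meaningful when u is in H1. *)
Definition wpartial (i : 'I_d) u : 'rV[R]_d -> R :=
  xget (fun=> 0) [set g | L2 g /\ is_weak_partial i u g].

(* H^1_0(Omega), i.e. u in H^1(Omega) with u = 0 on the boundary, as the closure
   of C_c^oo(Omega) in the H^1 norm. *)
Definition H10 u : Prop :=
  H1 u /\
  exists phi : nat -> 'rV[R]_d -> R,
    (forall n, test_function (phi n)) /\
    (fun n => \int[lebesgue_rV R d]_(x in Omega) (phi n x - u x) ^+ 2 +
              \sum_(i < d) \int[lebesgue_rV R d]_(x in Omega)
                 (partial i (phi n) x - wpartial i u x) ^+ 2) @ \oo --> (0 : R).

Definition component (i : 'I_d) w : 'rV[R]_d -> R := fun x => w x ord0 i.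

Definition H1_vec w : Prop := forall i, H1 (component i w).

Definition wgrad u : 'rV[R]_d -> 'rV[R]_d := fun x => \row_i wpartial i u x.

Definition wdiv w : 'rV[R]_d -> R :=
  fun x => \sum_(i < d) wpartial i (component i w) x.

End sobolev.

Definition curl_dim (d : nat) : nat :=
  match d with 2 => 1 | 3 => 3 | _ => 0 end.

(* For d = 3 the indices j + 1 and j + 2 are taken modulo 3 in 'I_3, which gives
   the usual curl; curls have no component when d is not 2 or 3. *)
Definition wcurl (R : realType) (d : nat) :
    ('rV[R]_d -> 'rV[R]_d) -> 'rV[R]_d -> 'rV[R]_(curl_dim d) :=
  match d with
  | 2 => fun w x => const_mx
      (wpartial (0 : 'I_2) (component (1 : 'I_2) w) x -
       wpartial (1 : 'I_2) (component (0 : 'I_2) w) x)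
  | 3 => fun w x => \row_(j < 3)
      (wpartial (j + 1) (component (j + 2) w) x -
       wpartial (j + 2) (component (j + 1) w) x)
  | _ => fun _ _ => 0
  end.

Section fosls.
Variables (R : realType) (d : nat).
Implicit Types (beta b u v : 'rV[R]_d -> R) (eps k : R).
Implicit Types U V : ('rV[R]_d -> R) * ('rV[R]_d -> 'rV[R]_d).

Definition dot n (p q : 'rV[R]_n) : R := \sum_(i < n) p ord0 i * q ord0 i.

Definition winner beta u v : R :=
  \int[lebesgue_rV R d]_(x in @Omega R d) (beta x * u x * v x).

Definition winner_vec beta n (w z : 'rV[R]_d -> 'rV[R]_n) : R :=
  \int[lebesgue_rV R d]_(x in @Omega R d) (beta x * dot (w x) (z x)).

Definition wnorm beta u : R := Num.sqrt (winner beta u u).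

Definition wnorm_vec beta n (w : 'rV[R]_d -> 'rV[R]_n) : R :=
  Num.sqrt (winner_vec beta w w).

Definition in_H1_product U : Prop := H1 U.1 /\ H1_vec U.2.

Definition fosls_op eps k b U : 'rV[R]_d -> 'rV[R]_(d + (1 + curl_dim d)) :=
  let: (u, w) := U in
  fun x =>
    row_mx (Num.sqrt eps *: (w x - wgrad u x))
   (row_mx (const_mx (- eps * (Num.sqrt (b x))^-1 * wdiv w x +
                      Num.sqrt (b x) * u x))
           (eps `^ (k / 2) *: wcurl w x)).

Definition fosls_form eps k b beta U V : R :=
  winner_vec beta (fosls_op eps k b U) (fosls_op eps k b V).

Definition product_norm eps k beta U : R :=
  let: (u, w) := U in
  Num.sqrt (wnorm beta u ^+ 2 + eps * wnorm_vec beta (wgrad u) ^+ 2 +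
            eps * wnorm_vec beta w ^+ 2 + eps ^+ 2 * wnorm beta (wdiv w) ^+ 2 +
            eps `^ k * wnorm_vec beta (wcurl w) ^+ 2).

End fosls.

(* Main.v *)
Require Import Defs.
From mathcomp Require Import all_boot all_order all_algebra.
From mathcomp Require Import all_classical all_reals all_analysis.
From mathcomp Require Import measurable_realfun ring lra.
Import Order.TTheory GRing.Theory Num.Theory.
Import numFieldNormedType.Exports.
Local Open Scope classical_set_scope.
Local Open Scope ring_scope.
Set Implicit Arguments.
Unset Strict Implicit.
Unset Printing Implicit Defensive.

(* Both bounds integrate pointwise inequalities.  Continuity is Young's
   inequality for the integrand, optimised over its parameter.  For coercivity,
   expanding the square leaves the cross terms
   -2 eps beta (w . grad u + u div w), whose integral equals that of
   2 eps u (w . grad beta) because u vanishes on the boundary; the hypothesis on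
   grad beta absorbs the latter into the square terms.

   The integration by parts is proved first for a test function phi in place of
   u.  Since beta is only C^1, beta phi is not a test function: beta is replaced
   by its Bernstein polynomials, which converge to it together with their first
   derivatives, pointwise and boundedly on the cube.  This uses that beta and
   its gradient are bounded, which follows from |grad ln beta| being bounded.
   Bernstein polynomials also show that bounded continuous functions are
   measurable for the sigma-algebra generated by the coordinates. *)

(** * Calculus on the open cube *)

Section calculus.
Context {R : realType} {d : nat}.
Implicit Types (f g : 'rV[R]_d -> R) (x y : 'rV[R]_d).
Local Notation e i := (delta_mx ord0 i : 'rV[R]_d).

Lemma shift_coord x (t : R) i j : (x + t *: e i) ord0 j = x ord0 j + t *+ (i == j).
Proof. by rewrite !mxE eqxx/= mulr_natr eq_sym. Qed.

Lemma open_Omega : open (@Omega R d).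
Proof.
rewrite openE => x Ox.
suff : \forall y \near x, forall i, 0 < (y : 'rV[R]_d) ord0 i < 1 by [].
apply: (@filter_forall _ _ (fun i (y : 'rV[R]_d) => is_true (0 < y ord0 i < 1)) (nbhs x)) => i.
have ci : (fun y : 'rV[R]_d => y ord0 i) @ x --> x ord0 i by exact: coord_continuous.
have /andP[x0 x1] := Ox i.
near=> y; apply/andP; split; near: y.
- exact: (cvgr_gt _ ci).
- exact: (cvgr_lt _ ci).
Unshelve. all: by end_near. Qed.

Lemma near_Omega f g x : Omega x -> (forall y, Omega y -> f y = g y) ->
  \near x, f x = g x.
Proof.
move=> Ox fg; apply: filterS (open_nbhs_nbhs (conj open_Omega Ox)).
by move=> y /fg.
Qed.

Lemma continuous_eq_Omega f g x : Omega x ->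
  (forall y, Omega y -> f y = g y) ->
  {for x, continuous f} -> {for x, continuous g}.
Proof.
move=> Ox fg cf; suff : g y @[y --> x] --> g x by [].
rewrite -(fg x Ox).
exact: cvg_trans (near_eq_cvg (F := nbhs x) (near_Omega Ox fg)) cf.
Qed.

Lemma partial_eq_Omega i f g x : Omega x ->
  (forall y, Omega y -> f y = g y) -> partial i f x = partial i g x.
Proof. by move=> Ox fg; apply: near_eq_derive; exact: near_Omega. Qed.

(** Continuity and derivatives are local and the cube is open, so agreement on the cube suffices.
    Inductions on [k] can thereby replace [partial i] of a sum or product by the usual formula,
    which is established only inside the cube. *)
Lemma Ck_eq_Omega k f g : (forall x, Omega x -> f x = g x) -> Ck k f -> Ck k g.
Proof.
elim: k f g => [|k IH] f g fg [cf df].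
  by split=> // x Ox; exact: (continuous_eq_Omega Ox fg (cf x Ox)).
split=> [x Ox|i]; first exact: (continuous_eq_Omega Ox fg (cf x Ox)).
have [dfi Cfi] := df i; split=> [x Ox|].
  by apply: near_eq_derivable (dfi x Ox); exact: near_Omega.
by apply: IH Cfi => x Ox; exact: partial_eq_Omega.
Qed.

Lemma Ck_continuous {k f} : Ck k f -> forall x, Omega x -> {for x, continuous f}.
Proof. by case: k => [|k] []. Qed.

Lemma CkW k f : Ck k.+1 f -> Ck k f.
Proof.
elim: k f => [|k IH] f [cf df]; split => // i.
by have [dfi Cfi] := df i; split => //; exact: IH.
Qed.

Lemma Ck_is_derive k f x i : Ck k.+1 f -> Omega x ->
  is_derive x (e i) f (partial i f x).
Proof. by case=> _ /(_ i)[df _] Ox; apply/derivableP/df. Qed.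

Lemma CkD k f g : Ck k f -> Ck k g -> Ck k (f \+ g).
Proof.
elim: k f g => [|k IH] f g Cf Cg.
  split=> // x Ox.
  exact: continuousD (Ck_continuous Cf Ox) (Ck_continuous Cg Ox).
split=> [x Ox|i].
  exact: continuousD (Ck_continuous Cf Ox) (Ck_continuous Cg Ox).
have dfg x : Omega x -> is_derive x (e i) (f \+ g) (partial i f x + partial i g x).
  by move=> Ox; exact: is_deriveD (Ck_is_derive i Cf Ox) (Ck_is_derive i Cg Ox).
split=> [x Ox|]; first exact: (@ex_derive _ _ _ _ _ _ _ (dfg x Ox)).
apply: (@Ck_eq_Omega _ (partial i f \+ partial i g)).
  by move=> x Ox /=; rewrite [RHS](@derive_val _ _ _ _ _ _ _ (dfg x Ox)).
by apply: IH; [case: Cf => _ /(_ i)[]|case: Cg => _ /(_ i)[]].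
Qed.

Lemma is_derive_partialM k f g x i : Ck k.+1 f -> Ck k.+1 g -> Omega x ->
  is_derive x (e i) (f \* g) (f x * partial i g x + g x * partial i f x).
Proof. by move=> Cf Cg Ox; exact: is_deriveM (Ck_is_derive i Cf Ox) (Ck_is_derive i Cg Ox). Qed.

Lemma CkM k f g : Ck k f -> Ck k g -> Ck k (f \* g).
Proof.
elim: k f g => [|k IH] f g Cf Cg.
  split=> // x Ox.
  exact: continuousM (Ck_continuous Cf Ox) (Ck_continuous Cg Ox).
split=> [x Ox|i].
  exact: continuousM (Ck_continuous Cf Ox) (Ck_continuous Cg Ox).
have dfg x Ox := @is_derive_partialM k f g x i Cf Cg Ox.
split=> [x Ox|]; first exact: (@ex_derive _ _ _ _ _ _ _ (dfg x Ox)).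
apply: (@Ck_eq_Omega _ ((f \* partial i g) \+ (g \* partial i f))).
  by move=> x Ox /=; rewrite [RHS](@derive_val _ _ _ _ _ _ _ (dfg x Ox)).
apply: CkD; apply: IH; [exact: CkW Cf| |exact: CkW Cg|].
- by case: Cg => _ /(_ i)[].
- by case: Cf => _ /(_ i)[].
Qed.

Lemma Ck_cst k (c : R) : Ck k (fun _ : 'rV[R]_d => c).
Proof.
elim: k c => [|k IH] c; first by split=> // x _; exact: cst_continuous.
split=> [x _|i]; first exact: cst_continuous.
split=> [x _|]; first exact: derivable_cst.
apply: Ck_eq_Omega (IH 0) => x _; rewrite /partial.
by rewrite (@derive_cst _ _ R c).
Qed.

Lemma is_derive_coord x (v : 'rV[R]_d) j :
  is_derive x v (fun y : 'rV[R]_d => y ord0 j) (v ord0 j).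
Proof.
apply: DeriveDef; first exact/diff_derivable/differentiable_coord.
have := @derive_mx R _ 1 d (@id 'rV[R]_d) x v (@derivable_id _ _ x v).
by rewrite derive_id => /matrixP/(_ ord0 j); rewrite mxE.
Qed.

Lemma Ck_coord k j : Ck k (fun y : 'rV[R]_d => y ord0 j).
Proof.
case: k => [|k]; split=> //; try by move=> x _; exact: coord_continuous.
move=> i; split=> [x _|].
  exact: (@ex_derive _ _ _ _ _ _ _ (is_derive_coord x (e i) j)).
apply: Ck_eq_Omega (Ck_cst k (e i ord0 j)) => x _.
by rewrite [RHS](@derive_val _ _ _ _ _ _ _ (is_derive_coord x (e i) j)).
Qed.

(** The two difference quotients coincide as functions of the increment. Directional derivatives
    thus become one-variable ones, to which the mean value theorem applies. *)
Lemma is_derive_line f x i (t df : R) :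
  is_derive (x + t *: e i) (e i) f df ->
  is_derive t (1 : R) (fun s : R => f (x + s *: e i)) df.
Proof.
move=> [ef <-].
have E : (fun h : R => h^-1 *: ((f \o shift (x + t *: e i)) (h *: e i) -
                                f (x + t *: e i))) =
         (fun h : R => h^-1 *: (((fun s : R => f (x + s *: e i)) \o shift t) (h *: (1:R)) -
                                f (x + t *: e i))).
  apply/funext => h /=; congr (_ *: (f _ - _)).
  by rewrite [h *: 1]mulr1 scalerDl addrCA.
apply: DeriveDef; first by rewrite /derivable -E.
by rewrite /derive -E.
Qed.

Lemma MVT_partial f x i (h : R) : 0 < h ->
  (forall t, 0 <= t <= h -> derivable f (x + t *: e i) (e i)) ->
  exists2 t, 0 <= t <= h & f (x + h *: e i) - f x = h * partial i f (x + t *: e i).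
Proof.
move=> h0 df.
have D t : 0 <= t <= h ->
    is_derive t 1 (fun s : R => f (x + s *: e i)) (partial i f (x + t *: e i)).
  by move=> th; apply/is_derive_line/derivableP/df.
have [| |c ch] := @MVT_segment R (fun s : R => f (x + s *: e i))
  (fun t => partial i f (x + t *: e i)) 0 h (ltW h0).
- by move=> t; rewrite in_itv/= => /andP[t0 t1]; apply: D; rewrite !ltW.
- apply: derivable_within_continuous => t; rewrite in_itv/= => th.
  exact: (@ex_derive _ _ _ _ _ _ _ (D t th)).
rewrite scale0r addr0 subr0 mulrC => ->.
by exists c => //; move: ch; rewrite in_itv.
Qed.

Lemma Omega_line x i (h t : R) : Omega x -> Omega (x + h *: e i) -> 0 <= t <= h ->
  Omega (x + t *: e i).
Proof.
move=> Ox Oh /andP[t0 th] j; rewrite shift_coord.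
have := Oh j; have := Ox j; rewrite shift_coord; case: (i == j); last by rewrite addr0.
by rewrite !mulr1n => /andP[? ?] /andP[? ?]; apply/andP; split; lra.
Qed.

Lemma MVT_partial_Omega f x i (h : R) : Ck 1 f -> 0 < h ->
  Omega x -> Omega (x + h *: e i) ->
  exists t, [/\ 0 <= t <= h, Omega (x + t *: e i) &
    f (x + h *: e i) - f x = h * partial i f (x + t *: e i)].
Proof.
move=> [_ /(_ i)[df _]] h0 Ox Oh; have [t th E] : exists2 t, 0 <= t <= h &
    f (x + h *: e i) - f x = h * partial i f (x + t *: e i).
  by apply: MVT_partial => // t th; apply: df; exact: (Omega_line _ Oh).
by exists t; split=> //; exact: (Omega_line _ Oh).
Qed.

End calculus.

(** * Bernstein polynomials *)

Section bernstein.
Context {R : realType} {d : nat}.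
Implicit Types (f g : 'rV[R]_d -> R) (x y : 'rV[R]_d) (h : R) (s : seq 'I_d).
Local Notation e i := (delta_mx ord0 i : 'rV[R]_d).

(* Expectation of [f] at the end of a random walk started at [y], whose step along
   the axis [j] is taken with probability [x ord0 j].  With [n] steps along each
   axis this is the Bernstein polynomial of [f] in [x]; in this recursive form
   derivatives and variance are inductions on the list of steps [s]. *)
Fixpoint walk h s f x y : R :=
  if s is j :: s' then
    x ord0 j * walk h s' f x (y + h *: e j) + (1 - x ord0 j) * walk h s' f x y
  else f y.

Lemma Ck_walk k h s f y : Ck k (fun x => walk h s f x y).
Proof.
elim: s y => [|j s IH] y /=; first exact: Ck_cst.
apply: (CkD (CkM (Ck_coord k j) (IH _)) (CkM _ (IH y))).
apply: (@Ck_eq_Omega _ _ _ ((fun=> 1) \+ ((fun=> -1) \* (fun x => x ord0 j)))).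
  by move=> x _ /=; rewrite mulN1r.
exact: CkD (Ck_cst _ _) (CkM (Ck_cst _ _) (Ck_coord _ _)).
Qed.

Lemma walk_swap h i j s f x y : walk h [:: i, j & s] f x y = walk h [:: j, i & s] f x y.
Proof. by rewrite /= [in RHS]addrAC; ring. Qed.

(** Steps commute, so an occurrence of [i] in [s] can be moved to the front without changing the
    expectation. *)
Lemma walk_rem h i s f x y : i \in s -> walk h (i :: rem i s) f x y = walk h s f x y.
Proof.
elim: s y => [//|j s IH] y; rewrite inE [rem _ _]/=.
have [-> //|_] := eqVneq j i; rewrite /= => /IH IHs.
by rewrite [LHS](walk_swap h i j) [in LHS]/walk -/walk; congr (_ * _ + _ * _); exact: IHs.
Qed.

(** Step probabilities depend on [x] and not on the current position, so the walk commutes with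
    translations. *)
Lemma walk_shiftB h s f x y (v : 'rV[R]_d) :
  walk h s (fun z => f (z + v) - f z) x y = walk h s f x (y + v) - walk h s f x y.
Proof. by elim: s y => [//|j s IH] y /=; rewrite !IH addrAC; ring. Qed.

(** Differentiating the probability of one step along [i] replaces that step by a forward difference
    of [f]. Steps commute, so all steps along [i] contribute the same amount, whence the factor
    [count_mem i s]. *)
Lemma is_derive_walk h s f x y i :
  is_derive x (e i) (fun x => walk h s f x y)
    ((count_mem i s)%:R * walk h (rem i s) (fun z => f (z + h *: e i) - f z) x y).
Proof.
elim: s y => [|j s IH] y.
  by rewrite /= mul0r; exact: is_derive_cst.
have cj := is_derive_coord x (e i) j.
have := is_deriveD (is_deriveM cj (IH (y + h *: e j)))
  (is_deriveM (is_deriveB (is_derive_cst (1 : R) x (e i)) cj) (IH y)).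
move=> /is_derive_eq; apply.
have sE (a b : R) : a *: b = a * b by [].
rewrite !sE mxE eqxx [count_mem _ _]/= [rem _ _]/=.
rewrite [(_ - _ : 'rV[R]_d -> R) x](_ : _ = 1 - x ord0 j)//.
have [->|ji] := eqVneq j i; last first.
  by rewrite /= (negbTE ji) add0n/=; ring.
rewrite /= eqxx/=.
set D := fun z : 'rV[R]_d => f (z + h *: e i) - f z.
transitivity ((count_mem i s)%:R * walk h (i :: rem i s) D x y + walk h s D x y).
  by rewrite [X in _ = _ + X]walk_shiftB/=; ring.
rewrite natrD; have [si|si] := boolP (i \in s).
  by rewrite walk_rem//; ring.
by rewrite (count_memPn si); ring.
Qed.

(** With [c_j] steps along the axis [j], that coordinate of the endpoint has mean [y_j + h c_j x_j]
    and variance [c_j h^2 x_j (1 - x_j)]. The summand is squared bias plus variance, so the sum is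
    the expected squared distance to [x], and the claim is the expectation of the quadratic bound on
    [f]. *)
Lemma walk_close h s f x y (c eta A : R) : 0 <= h -> Omega x ->
  (forall z : 'rV[R]_d, (forall j, y ord0 j <= z ord0 j <= y ord0 j + h * (count_mem j s)%:R) ->
    `|f z - c| <= eta + A * \sum_j (z ord0 j - x ord0 j) ^+ 2) ->
  `|walk h s f x y - c| <= eta + A * \sum_j
    ((y ord0 j + h * (count_mem j s)%:R * x ord0 j - x ord0 j) ^+ 2 +
     (count_mem j s)%:R * h ^+ 2 * (x ord0 j * (1 - x ord0 j))).
Proof.
move=> h0 Ox; elim: s y => [|j s IH] y H.
  rewrite /=; apply: le_trans (H y _) _.
    by move=> j /=; rewrite mulr0 addr0 lexx.
  by under [in leRHS]eq_bigr do rewrite mulr0 mul0r addr0 !mul0r addr0.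
have H1 := IH (y + h *: e j); have H2 := IH y.
have /andP[x0 x1] := Ox j.
have -> : walk h (j :: s) f x y - c =
    x ord0 j * (walk h s f x (y + h *: e j) - c) +
    (1 - x ord0 j) * (walk h s f x y - c) by rewrite /=; ring.
apply: le_trans (ler_normD _ _) _.
rewrite !normrM (gtr0_norm x0) (@gtr0_norm _ (1 - _)) ?subr_gt0//.
apply: (@le_trans _ _ (x ord0 j * (eta + A * \sum_(j0 < d)
    (((y + h *: e j) ord0 j0 + h * (count_mem j0 s)%:R * x ord0 j0 - x ord0 j0) ^+ 2 +
     (count_mem j0 s)%:R * h ^+ 2 * (x ord0 j0 * (1 - x ord0 j0)))) +
  (1 - x ord0 j) * (eta + A * \sum_(j0 < d)
    ((y ord0 j0 + h * (count_mem j0 s)%:R * x ord0 j0 - x ord0 j0) ^+ 2 +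
     (count_mem j0 s)%:R * h ^+ 2 * (x ord0 j0 * (1 - x ord0 j0)))))).
  apply: lerD; apply: ler_wpM2l; [exact: ltW| |by rewrite subr_ge0 ltW|].
    apply: H1 => z Hz; apply: H => k; have := Hz k; rewrite shift_coord/= natrD.
    by have [<-|jk] := eqVneq j k; rewrite ?mulr1n ?mulr0n /= => /andP[? ?]; apply/andP; split; lra.
  apply: H2 => z Hz; apply: H => k; have := Hz k; rewrite /= natrD.
  by have [<-|jk] := eqVneq j k; rewrite /= => /andP[? ?]; apply/andP; split; lra.
set S1 := \sum_(j0 < d) _; set S2 := \sum_(j0 < d) _; set S3 := \sum_(j0 < d) _.
(* Conditioning on the first step: the second moment about [x] is the mixture of those of the two
   continuations. *)
suff -> : S3 = x ord0 j * S1 + (1 - x ord0 j) * S2.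
  by rewrite le_eqVlt; apply/orP; left; apply/eqP; ring.
rewrite /S1 /S2 /S3 !mulr_sumr -big_split; apply: eq_bigr => k _.
rewrite shift_coord /= natrD; have [<-|jk] := eqVneq j k.
  by rewrite mulr1n/=; ring.
by rewrite mulr0n/=; ring.
Qed.

(** Within the continuity radius [dl] the error is below [eta]. Farther away some coordinate differs
    by at least [dl], so the trivial bound [2 * M] is at most [2 * M / dl ^+ 2] times the squared
    distance. Only second moments of the walk are then needed. *)
Lemma bounded_quadratic_modulus f x (M eta : R) : Omega x ->
  (forall y, Omega y -> `|f y| <= M) -> {for x, continuous f} -> 0 < eta ->
  exists2 A, 0 <= A & forall z, Omega z ->
    `|f z - f x| <= eta + A * \sum_j (z ord0 j - x ord0 j) ^+ 2.
Proof.
move=> Ox fM cf eta0.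
have M0 : 0 <= M by apply: le_trans (fM x Ox).
have /nbhs_ballP[dl /= dl0 fdl] : \forall z \near x, `|f x - f z| < eta.
  by have /cvgrPdist_lt/(_ _ eta0) := cf.
exists (2 * M / dl ^+ 2).
  by rewrite divr_ge0 ?mulr_ge0// ?exprn_ge0 ?ltW.
move=> z Oz.
have sqs_ge0 : 0 <= \sum_(j < d) (z ord0 j - x ord0 j) ^+ 2.
  by apply: sumr_ge0 => j _; exact: sqr_ge0.
have [zx|] := boolP [forall j, `|x ord0 j - z ord0 j| < dl].
  have fxz : `|f x - f z| < eta.
    by apply: fdl; split=> // i j; rewrite (ord1 i); exact: (forallP zx j).
  rewrite distrC (le_trans (ltW fxz))// lerDl mulr_ge0//.
  by rewrite divr_ge0 ?mulr_ge0// ?exprn_ge0 ?ltW.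
rewrite negb_forall => /existsP[j]; rewrite -leNgt => dlj.
apply: (@le_trans _ _ (2 * M)).
  apply: le_trans (ler_normB _ _) _.
  by have := fM z Oz; have := fM x Ox; lra.
apply: ler_wpDl; first exact: ltW.
rewrite mulrAC -mulrA; apply: ler_peMr; first exact: mulr_ge0.
rewrite ler_pdivlMr ?exprn_gt0// mul1r.
rewrite (bigD1 j)//=; apply: ler_wpDr; first by apply: sumr_ge0 => k _; exact: sqr_ge0.
rewrite -[leRHS]real_normK ?num_real// distrC.
by apply: lerXn2r => //; rewrite nnegrE ?normr_ge0// ltW.
Qed.

(** Here [h] is the mesh, [N] the full number of steps and [c] is short of [N] by at most one. The
    bias equals [h * (1 - u)] with [u = (N + 2 - c) * t] in [0, 3], so its square is at most
    [4 * h]; the variance is at most [h] because [c * h <= 1]. *)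
Lemma step_error (h N c t : R) : 0 < h -> (N + 2) * h = 1 ->
  0 <= c -> c <= N -> N <= c + 1 -> 0 < t -> t < 1 ->
  (h + h * c * t - t) ^+ 2 + c * h ^+ 2 * (t * (1 - t)) <= 5 * h.
Proof.
move=> h0 Nh c0 cN Nc t0 t1.
have [u [u0 u3 ->]] : exists u, [/\ 0 <= u, u <= 3 & h + h * c * t - t = h * (1 - u)].
  exists ((N + 2 - c) * t); split; first by rewrite mulr_ge0//; lra.
    by rewrite -[leRHS]mulr1; apply: ler_pM; lra.
  by rewrite mulrBr mulrA mulrBr (mulrC h (N + 2)) Nh; ring.
have ch0 : 0 <= c * h by rewrite mulr_ge0// ltW.
have ch1 : c * h <= 1 by rewrite -Nh; apply: ler_wpM2r; lra.
have hh : h * h <= h by rewrite -[leRHS]mulr1; apply: ler_pM => //; nra.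
have tt0 : 0 <= t * (1 - t) by nra.
have tt1 : t * (1 - t) <= 1 by nra.
have u2 : (1 - u) ^+ 2 <= 4 by nra.
have E1 : (h * (1 - u)) ^+ 2 <= h * 4.
  rewrite (_ : _ ^+ 2 = (h * h) * (1 - u) ^+ 2); last by ring.
  by apply: ler_pM => //; [nra|exact: sqr_ge0].
have E2 : c * h ^+ 2 * (t * (1 - t)) <= h.
  rewrite (_ : _ * (t * (1 - t)) = h * ((c * h) * (t * (1 - t)))); last by ring.
  by rewrite -[leRHS]mulr1 ler_pM2l//; apply: mulr_ile1.
by lra.
Qed.

(** The form covers two uses: [g = f] on the full grid, and [g] a difference quotient with [f] the
    partial derivative. The latter has one step fewer, and the mean value theorem moves its
    evaluation point by at most the mesh. *)
Lemma walk_approx f x (M eta : R) : Omega x ->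
  (forall y, Omega y -> `|f y| <= M) -> {for x, continuous f} -> 0 < eta ->
  exists C : R, forall n s (g : 'rV[R]_d -> R),
    (forall j, (count_mem j s <= n.+1 <= (count_mem j s).+1)%N) ->
    (forall y : 'rV[R]_d,
      (forall j, n.+3%:R^-1 <= y ord0 j <= n.+3%:R^-1 + n.+3%:R^-1 * (count_mem j s)%:R) ->
      exists z, [/\ Omega z, forall j, `|z ord0 j - y ord0 j| <= n.+3%:R^-1 & g y = f z]) ->
    `|walk n.+3%:R^-1 s g x (const_mx n.+3%:R^-1) - f x| <= eta + C / n.+3%:R.
Proof.
move=> Ox fM cf eta0.
have [A A0 fA] := bounded_quadratic_modulus Ox fM cf eta0.
(* The constant 12 is 2 for the displacement of [z] from [y], plus twice the 5 of [step_error]. *)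
exists (12 * A * d%:R) => n s g sn gf; set h : R := n.+3%:R^-1.
have h0 : 0 < h by rewrite invr_gt0.
have h1 : h <= 1 by rewrite invf_le1// ler1n.
have nh : n.+3%:R * h = 1 by rewrite mulfV.
(* The inequality [(z - x)^2 <= 2 (z - y)^2 + 2 (y - x)^2] transfers the modulus of [f] at [z] to
   the grid point [y], which doubles [A] and adds a term of order [h ^+ 2]. *)
apply: le_trans (@walk_close h s g x (const_mx h) (f x)
  (eta + A * (2 * d%:R * h ^+ 2)) (2 * A) (ltW h0) Ox _) _.
  move=> y yj; have /gf[z [Oz zy ->]] : forall j, h <= y ord0 j <=
      h + h * (count_mem j s)%:R by move=> j; have := yj j; rewrite mxE.
  apply: le_trans (fA z Oz) _.
  suff S : \sum_(j < d) (z ord0 j - x ord0 j) ^+ 2 <=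
      2 * d%:R * h ^+ 2 + 2 * \sum_(j < d) (y ord0 j - x ord0 j) ^+ 2.
    by have := ler_wpM2l A0 S; lra.
  have -> : 2 * d%:R * h ^+ 2 = \sum_(j < d) (2 * h ^+ 2).
    by rewrite sumr_const card_ord -[RHS]mulr_natl; ring.
  rewrite mulr_sumr -big_split/=; apply: ler_sum => j _.
  have := zy j; rewrite -/h.
  set a := z _ _; set b := y _ _; set c := x _ _ => ab.
  have : (a - b) ^+ 2 <= h ^+ 2.
    rewrite -[leLHS]real_normK ?num_real//.
    by apply: lerXn2r => //; rewrite nnegrE ?normr_ge0// ltW.
  have := sqr_ge0 (a - b - (b - c)); rewrite !expr2; nra.
rewrite -addrA lerD2l.
apply: (@le_trans _ _ (A * (2 * d%:R * h ^+ 2) + 2 * A * \sum_(j < d) (5 * h))).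
  rewrite lerD2l ler_wpM2l ?mulr_ge0//; apply: ler_sum => j _.
  rewrite mxE; have /andP[x0 x1] := Ox j; have /andP[] := sn j.
  move=> c1 c2; apply: (@step_error _ n.+1%:R) => //.
  - by rewrite -natrD addn2.
  - by rewrite ler_nat.
  - by rewrite natr1 ler_nat.
rewrite sumr_const card_ord -[5 * h *+ d]mulr_natl.
have -> : 12 * A * d%:R / n.+3%:R = A * (2 * d%:R * h) + 2 * A * (d%:R * (5 * h)).
  by rewrite -/h; ring.
rewrite lerD2r; apply: ler_wpM2l => //; apply: ler_wpM2l; first exact: mulr_ge0.
by rewrite expr2 ler_piMl// ltW.
Qed.

Lemma cvg_approx_inv_nat (u : nat -> R) (l : R) :
  (forall eta, 0 < eta -> exists C, forall n, `|u n - l| <= eta + C / n.+3%:R) ->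
  u @ \oo --> l.
Proof.
move=> H; apply/cvgrPdist_le => eps eps0.
have e20 : 0 < eps / 2 by rewrite divr_gt0.
have [C uC] := H _ e20.
near=> n; rewrite distrC; apply: le_trans (uC n) _.
rewrite [leRHS](splitr eps) lerD2l.
have -> : C / n.+3%:R <= eps / 2.
  rewrite ler_pdivrMr// mulrC -ler_pdivrMr//.
  apply: (@le_trans _ _ n%:R); last by rewrite ler_nat; do 3 apply: leqW.
  by near: n; exact: nbhs_infty_ger.
by [].
Unshelve. all: by end_near. Qed.

Definition grid_steps n : seq 'I_d := flatten (nseq n.+1 (enum 'I_d)).

Lemma count_grid_steps n j : count_mem j (grid_steps n) = n.+1.
Proof.
rewrite count_flatten map_nseq sumn_nseq count_uniq_mem ?enum_uniq//.
by rewrite mem_enum mul1n.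
Qed.

(* With mesh 1/(n+3) and n+1 steps per axis, started at (1/(n+3), ..., 1/(n+3)),
   the grid stays inside the open cube, where alone [f] is controlled. *)
Definition bernstein n f x : R :=
  walk n.+3%:R^-1 (grid_steps n) f x (const_mx n.+3%:R^-1).

Lemma Omega_grid n s y : (forall j, (count_mem j s <= n.+1)%N) ->
  (forall j, n.+3%:R^-1 <= y ord0 j <= n.+3%:R^-1 + n.+3%:R^-1 * (count_mem j s)%:R) ->
  Omega y.
Proof.
move=> sn yj j; have /andP[y0 y1] := yj j; set h : R := n.+3%:R^-1 in y0 y1.
have h0 : 0 < h by rewrite invr_gt0.
have nh : n.+3%:R * h = 1 by rewrite mulfV.
have nE : n.+3%:R = n.+1%:R + 2 :> R by rewrite -natrD addn2.
have c1 : (count_mem j s)%:R <= n.+1%:R :> R by rewrite ler_nat.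
apply/andP; split; first exact: lt_le_trans y0.
by apply: le_lt_trans y1 _; nra.
Qed.

Lemma cvg_bernstein f x (M : R) : Omega x ->
  (forall y, Omega y -> `|f y| <= M) -> {for x, continuous f} ->
  bernstein ^~ f ^~ x @ \oo --> f x.
Proof.
move=> Ox fM cf; apply: cvg_approx_inv_nat => eta eta0.
have [C fC] := walk_approx Ox fM cf eta0; exists C => n; apply: fC.
  by move=> j; rewrite count_grid_steps leqnn leqnSn.
move=> y yj; exists y; split=> //.
  by apply: Omega_grid yj => j; rewrite count_grid_steps.
by move=> j; rewrite subrr normr0 invr_ge0.
Qed.

Lemma walk_le n s g x (M : R) : Omega x ->
  (forall y : 'rV[R]_d,
    (forall j, n.+3%:R^-1 <= y ord0 j <= n.+3%:R^-1 + n.+3%:R^-1 * (count_mem j s)%:R) ->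
    `|g y| <= M) ->
  `|walk n.+3%:R^-1 s g x (const_mx n.+3%:R^-1)| <= M.
Proof.
move=> Ox gM; have h0 : 0 <= n.+3%:R^-1 :> R by rewrite invr_ge0.
rewrite -[walk _ _ _ _ _]subr0.
apply: le_trans (walk_close (A := 0) (eta := M) h0 Ox _) _.
  move=> y yj; rewrite subr0 mul0r addr0; apply: gM => j.
  by have := yj j; rewrite mxE.
by rewrite mul0r addr0.
Qed.

Lemma bernstein_le n f x (M : R) : Omega x ->
  (forall y, Omega y -> `|f y| <= M) -> `|bernstein n f x| <= M.
Proof.
move=> Ox fM; apply: walk_le => // y yj; apply: fM.
by apply: Omega_grid yj => j; rewrite count_grid_steps.
Qed.

End bernstein.

(** * Derivatives of Bernstein polynomials, and measurability of bounded continuous functions *)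

Section bernstein_partial.
Context {R : realType} {d : nat}.
Implicit Types (f g : 'rV[R]_d -> R) (x y : 'rV[R]_d).
Local Notation e i := (delta_mx ord0 i : 'rV[R]_d).

Lemma walkZ h s (c : R) g x y : walk h s (fun z => c * g z) x y = c * walk h s g x y.
Proof. by elim: s y => [//|j s IH] y /=; rewrite !IH; ring. Qed.

Lemma Ck_bernstein k n f : Ck k (bernstein n f).
Proof. exact: Ck_walk. Qed.

Lemma count_grid_steps_rem n (i j : 'I_d) :
  (count_mem j (rem i (grid_steps n)) <= n.+1 <= (count_mem j (rem i (grid_steps n))).+1)%N.
Proof.
rewrite count_mem_rem count_grid_steps leq_subr/=.
by case: (_ == _); rewrite /= ?subn1 ?subn0.
Qed.

(** Since one step along [i] has been removed, [y] shifted by the mesh along [i] is still in the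
    grid. The whole segment then lies in the cube and the mean value theorem applies. *)
Lemma forward_difference n i f y : Ck 1 f ->
  (forall j, n.+3%:R^-1 <= y ord0 j <=
     n.+3%:R^-1 + n.+3%:R^-1 * (count_mem j (rem i (grid_steps n)))%:R) ->
  exists z, [/\ Omega z, forall j, `|z ord0 j - y ord0 j| <= n.+3%:R^-1 &
    n.+3%:R * (f (y + n.+3%:R^-1 *: e i) - f y) = partial i f z].
Proof.
set h : R := n.+3%:R^-1 => Cf yj.
have h0 : 0 < h by rewrite invr_gt0.
have Oy : Omega y.
  by apply: Omega_grid yj => j; have /andP[] := count_grid_steps_rem n i j.
have Oyh : Omega (y + h *: e i).
  apply: (@Omega_grid _ _ n (grid_steps n)); first by move=> j; rewrite count_grid_steps.
  move=> j; rewrite shift_coord; have := yj j; rewrite count_mem_rem count_grid_steps.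
  have [_|_] := eqVneq i j; rewrite ?subn1/= ?subn0 ?mulr1n ?mulr0n ?addr0 //.
  by rewrite -/h -natr1 mulrDr mulr1 => /andP[? ?]; apply/andP; split; lra.
have [t [/andP[t0 th] Ot ->]] := MVT_partial_Omega Cf h0 Oy Oyh.
exists (y + t *: e i); split=> //; last by rewrite mulrA mulfV// mul1r.
move=> j; rewrite shift_coord addrC addKr.
case: (i == j); rewrite ?mulr1n ?mulr0n ?normr0; first by rewrite ger0_norm.
exact: ltW.
Qed.

(** The prefactor is the number of steps along [i] times the mesh; normalising the forward
    difference by the mesh leaves it in front. *)
Lemma partial_bernstein n i f x : partial i (bernstein n f) x =
  n.+1%:R / n.+3%:R * walk n.+3%:R^-1 (rem i (grid_steps n))
    (fun y => n.+3%:R * (f (y + n.+3%:R^-1 *: e i) - f y)) x (const_mx n.+3%:R^-1).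
Proof.
rewrite [LHS](@derive_val _ _ _ _ _ _ _ (is_derive_walk _ _ f x _ i)).
by rewrite walkZ count_grid_steps mulrA divfK.
Qed.

Lemma cvg_partial_bernstein i f x (M : R) : Omega x -> Ck 1 f ->
  (forall y, Omega y -> `|partial i f y| <= M) ->
  partial i (bernstein n f) x @[n --> \oo] --> partial i f x.
Proof.
move=> Ox Cf fM.
apply: (@cvg_approx_inv_nat _ (fun n => partial i (bernstein n f) x)) => eta eta0.
have cpf : {for x, continuous (partial i f)} by case: Cf => _ /(_ i)[_ []] /(_ x Ox).
(* The extra [2 * M] pays for the prefactor, which is [1 - 2 / n.+3%:R] and multiplies a walk
   bounded by [M]. *)
have [C fC] := walk_approx Ox fM cpf eta0; exists (C + 2 * M) => n.
rewrite partial_bernstein; set W := walk _ _ _ _ _.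
have WM : `|W| <= M.
  apply: walk_le => // y yj.
  by have [z [Oz _ ->]] := forward_difference Cf yj; exact: fM.
have WF : `|W - partial i f x| <= eta + C / n.+3%:R.
  apply: fC; first exact: count_grid_steps_rem.
  by move=> y yj; exact: forward_difference.
have -> : n.+1%:R / n.+3%:R * W - partial i f x = (W - partial i f x) - (2 / n.+3%:R) * W.
  have -> : n.+1%:R = n.+3%:R - 2 :> R by rewrite -natrB.
  by field.
apply: le_trans (ler_normB _ _) _; rewrite [leRHS](_ : _ = (eta + C / n.+3%:R) + 2 / n.+3%:R * M).
  by apply: lerD => //; rewrite normrM (ger0_norm (divr_ge0 _ _))// ler_wpM2l ?divr_ge0.
by ring.
Qed.

Lemma partial_bernstein_le n i f x (M : R) : Omega x -> Ck 1 f ->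
  (forall y, Omega y -> `|partial i f y| <= M) ->
  `|partial i (bernstein n f) x| <= M.
Proof.
move=> Ox Cf fM; rewrite partial_bernstein normrM.
rewrite -[leRHS]mul1r; apply: ler_pM => //.
  by rewrite ger0_norm ?divr_ge0// ler_pdivrMr// mul1r ler_nat leqW.
apply: walk_le => // y yj.
by have [z [Oz _ ->]] := forward_difference Cf yj; exact: fM.
Qed.

Lemma measurable_fun_coord (D : set 'rV[R]_d) j : measurable_fun D (fun x => x ord0 j).
Proof. exact: measurable_funTS (measurable_coord_rV j). Qed.

Lemma measurable_Omega : measurable (@Omega R d).
Proof.
have -> : @Omega R d = \bigcap_(i in [set: 'I_d]) ((fun x : 'rV[R]_d => x ord0 i) @^-1` `]0, 1[).
  by apply/seteqP; split=> [x Ox i _|x Ox i]; have := Ox i; rewrite /= in_itv//=; exact.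
apply: fin_bigcap_measurable; first exact: finite_finset.
by move=> i _; rewrite -[X in measurable X]setTI; apply: measurable_coord_rV.
Qed.

Lemma measurable_walk (D : set 'rV[R]_d) h s f y : measurable_fun D (fun x => walk h s f x y).
Proof.
elim: s y => [|j s IH] y /=; first exact: measurable_cst.
apply: measurable_funD; apply: measurable_funM => //; first exact: measurable_fun_coord.
by apply: measurable_funB => //; exact: measurable_fun_coord.
Qed.

Lemma measurable_bounded_continuous f (M : R) :
  (forall x, Omega x -> `|f x| <= M) -> (forall x, Omega x -> {for x, continuous f}) ->
  measurable_fun (@Omega R d) f.
Proof.
move=> fM cf; apply: (measurable_fun_cvg (h := fun n => bernstein n f)).
  by move=> n; exact: measurable_walk.
by move=> x Ox; exact: (cvg_bernstein Ox fM (cf x Ox)).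
Qed.

End bernstein_partial.

(** * Stability, boundedness and measurability of test functions *)

Section test_functions.
Context {R : realType} {d : nat}.
Implicit Types (f g phi : 'rV[R]_d -> R) (x y : 'rV[R]_d).

Lemma test_functionM f phi : (forall k, Ck k f) -> test_function phi ->
  test_function (f \* phi).
Proof.
move=> Cf [Cphi [K [cK KO phi0]]]; split=> [k|]; first exact: CkM.
by exists K; split=> // x Kx; rewrite /= phi0// mulr0.
Qed.

Lemma test_function_partial i phi : test_function phi -> test_function (partial i phi).
Proof.
move=> [Cphi [K [cK KO phi0]]]; split=> [k|].
  by have [_ /(_ i)[]] := Cphi k.+1.
exists K; split=> // x Kx.
(* As [K] is closed, a point outside it has a neighbourhood on which [phi] vanishes, and so does its
   derivative there; [K] serves for the derivative as well. *)
have clK : closed K by apply: compact_closed cK; exact: norm_hausdorff.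
have oK : open (~` K) by exact: closed_openC.
rewrite /partial (@near_eq_derive _ _ _ phi (fun=> 0)); first exact: (@derive_cst _ _ R).
by apply: filterS (open_nbhs_nbhs (conj oK Kx)) => y /phi0.
Qed.

Lemma test_function_bounded phi : test_function phi ->
  exists M, forall x, `|phi x| <= M.
Proof.
move=> [Cphi [K [cK KO phi0]]].
have cphiK : compact (phi @` K).
  apply: continuous_compact => //; apply: continuous_in_subspaceT => x /set_mem Kx.
  exact: (Ck_continuous (Cphi 0%N) (KO x Kx)).
have [M M0 HM] := ex_strict_bound_gt0 (compact_bounded cphiK).
exists M => x; have [Kx|Kx] := pselect (K x); last by rewrite phi0// normr0 ltW.
by apply/ltW/HM; exists x.
Qed.

Lemma test_function_measurable phi : test_function phi -> measurable_fun (@Omega R d) phi.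
Proof.
move=> tphi; have [M phiM] := test_function_bounded tphi.
apply: (@measurable_bounded_continuous _ _ _ M) => // x Ox.
by apply: (Ck_continuous (proj1 tphi 0%N)).
Qed.

End test_functions.

(** * Weights with bounded logarithmic gradient *)

Section weight.
Context {R : realType} {d : nat}.
Local Notation e i := (delta_mx ord0 i : 'rV[R]_d).
Variables (beta : 'rV[R]_d -> R) (K : R).
Hypotheses (beta_C1 : Ck 1 beta) (beta_gt0 : forall x, Omega x -> 0 < beta x)
  (K_ge0 : 0 <= K)
  (dbeta : forall i x, Omega x -> `|partial i beta x| <= K * beta x).

(** The derivative of [ln beta] along an axis is [partial i beta / beta], bounded by [K]; the mean
    value theorem on a segment of length at most 1 concludes. *)
Lemma ln_weight_step i (x : 'rV[R]_d) (h : R) : 0 < h -> h <= 1 ->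
  Omega x -> Omega (x + h *: e i) ->
  `|ln (beta (x + h *: e i)) - ln (beta x)| <= K.
Proof.
move=> h0 h1 Ox Oh.
have O t : 0 <= t <= h -> Omega (x + t *: e i) by exact: Omega_line.
have D t : 0 <= t <= h -> is_derive t 1 (fun s : R => ln (beta (x + s *: e i)))
    ((beta (x + t *: e i))^-1 * partial i beta (x + t *: e i)).
  move=> /O Ot; apply: is_derive1_comp; first exact: is_derive1_ln (beta_gt0 Ot).
  exact: is_derive_line (Ck_is_derive i beta_C1 Ot).
have [| |c ch] := @MVT_segment R (fun s : R => ln (beta (x + s *: e i)))
  (fun t => (beta (x + t *: e i))^-1 * partial i beta (x + t *: e i)) 0 h (ltW h0).
- by move=> t; rewrite in_itv/= => /andP[t0 t1]; apply: D; rewrite !ltW.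
- apply: derivable_within_continuous => t; rewrite in_itv/= => th.
  exact: (@ex_derive _ _ _ _ _ _ _ (D t th)).
rewrite scale0r addr0 subr0 => ->.
have {}/O Oc : 0 <= c <= h by move: ch; rewrite in_itv.
set p := partial i beta _; set q := beta _; suff : `|q^-1 * p * h : R| <= K by [].
rewrite normrM (gtr0_norm h0) -[leRHS]mulr1; apply: ler_pM => //; first exact: ltW.
rewrite normrM normfV (gtr0_norm (beta_gt0 Oc)) mulrC.
by rewrite ler_pdivrMr ?beta_gt0//; exact: dbeta.
Qed.

(* The path from the centre of the cube to [x] moves one coordinate at a time. *)
Lemma ln_weight_path (x : 'rV[R]_d) (k : nat) : Omega x -> (k <= d)%N ->
  `|ln (beta (\row_j if (j < k)%N then x ord0 j else 2^-1)) -
    ln (beta (const_mx 2^-1))| <= K * k%:R.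
Proof.
move=> Ox; elim: k => [_|k IH kd].
  rewrite mulr0 (_ : \row_j _ = const_mx 2^-1) ?subrr ?normr0//.
  by apply/rowP => j; rewrite !mxE.
set z := fun k : nat => \row_(j < d) if (j < k)%N then x ord0 j else 2^-1 : R.
have Oz m : Omega (z m).
  move=> j; rewrite mxE; case: ifP => _; first exact: Ox.
  by apply/andP; split; lra.
have {}IH := IH (ltnW kd); pose i := Ordinal kd.
have zS : z k.+1 = z k + (x ord0 i - 2^-1) *: e i.
  apply/rowP => j; rewrite shift_coord !mxE ltnS leq_eqVlt.
  rewrite (_ : (i == j) = (j == k :> nat)); last by rewrite -val_eqE eq_sym.
  have [jk|jk] := eqVneq (j : nat) k; last by rewrite mulr0n addr0.
  have -> : j = i by exact: val_inj.
  by rewrite /= ltnn mulr1n addrC subrK.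
have step : `|ln (beta (z k.+1)) - ln (beta (z k))| <= K.
  have /andP[x0 x1] := Ox i.
  (* [ln_weight_step] moves in the positive direction only, so below the centre the two endpoints
     are exchanged. *)
  have [xi|xi|xi] := ltgtP (x ord0 i) 2^-1.
  - have zk : z k = z k.+1 + (2^-1 - x ord0 i) *: e i.
      by rewrite zS -addrA -scalerDl (_ : x ord0 i - 2^-1 + _ = 0) ?scale0r ?addr0//; ring.
    rewrite distrC [in ln (beta (z k))]zk; apply: ln_weight_step; rewrite -?zk//; lra.
  - rewrite [in z k.+1]zS; apply: ln_weight_step; rewrite -?zS//; lra.
  - by rewrite zS xi subrr scale0r addr0 subrr normr0.
rewrite [leRHS](_ : _ = K + K * k%:R); last by rewrite -natr1; ring.
apply: le_trans (ler_distD (ln (beta (z k))) _ _) _.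
exact: lerD step IH.
Qed.

Lemma weight_bounded : exists M, forall x, Omega x -> beta x <= M.
Proof.
exists (expR (K * d%:R + ln (beta (const_mx 2^-1)))) => x Ox.
rewrite -[leLHS]lnK ?posrE ?beta_gt0// ler_expR.
have := ln_weight_path Ox (leqnn d).
rewrite (_ : \row_j _ = x); last by apply/rowP => j; rewrite !mxE ltn_ord.
by rewrite ler_norml => /andP[_]; lra.
Qed.

End weight.

(** * Integration over the cube *)

Section measure.
Context {R : realType}.

(** Splitting off the first coordinate turns the cube into a product with an interval of length 1;
    in dimension 0 the measure is a Dirac mass. *)
Lemma lebesgue_Omega_lty n : (lebesgue_rV R n (@Omega R n) < +oo)%E.
Proof.
elim: n => [|n IH].
  rewrite /= diracE; exact: ltry.
have E : @cons_rV R n @^-1` @Omega R n.+1 = `]0, 1[ `*` @Omega R n.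
  apply/seteqP; split=> [[a y] /= Oy|[a y] /= [a01 Oy] i].
    split=> /=; first by have := Oy ord0; rewrite cons_rV0 in_itv.
    by move=> i; have := Oy (lift ord0 i); rewrite cons_rVS.
  have [j ->|->] := unliftP ord0 i; first by rewrite cons_rVS.
  by rewrite cons_rV0; move: a01; rewrite in_itv.
have -> : lebesgue_rV R n.+1 (@Omega R n.+1) =
    (lebesgue_measure \x lebesgue_rV R n)%E (`]0, 1[ `*` @Omega R n) by rewrite -E.
rewrite product_measure1E//; last exact: measurable_Omega.
by rewrite /= lebesgue_measure_itv/= lte_fin ltr01 oppr0 adde0 mul1e.
Qed.

End measure.

Section integration.
Context {R : realType} {d : nat}.
Implicit Types (f g phi : 'rV[R]_d -> R).
Local Notation mu := (lebesgue_rV R d).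
Local Notation intg f := (mu.-integrable (@Omega R d) (EFin \o f)).
Let mO := @measurable_Omega R d.

Lemma intg_measurable f : intg f -> measurable_fun (@Omega R d) f.
Proof. by move=> /measurable_int/measurable_EFinP. Qed.

Lemma intg_le f g : measurable_fun (@Omega R d) f ->
  (forall x, Omega x -> `|f x| <= g x) -> intg g -> intg f.
Proof.
move=> mf fg; apply: le_integrable => //; first exact/measurable_EFinP.
by move=> x Ox /=; rewrite lee_fin (le_trans (fg x Ox))// ler_norm.
Qed.

Lemma intg_eq f g : (forall x, Omega x -> f x = g x) -> intg f -> intg g.
Proof. by move=> fg; apply: eq_integrable => // x /set_mem Ox /=; rewrite fg. Qed.

Lemma intgD f g : intg f -> intg g -> intg (fun x => f x + g x).
Proof. by move=> If Ig; exact: (integrableD mO If Ig). Qed.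

Lemma intgZ (c : R) f : intg f -> intg (fun x => c * f x).
Proof. by move=> If; exact: (integrableZl mO c If). Qed.

Lemma intg_sum n (f : 'I_n -> 'rV[R]_d -> R) :
  (forall i, intg (f i)) -> intg (fun x => \sum_i f i x).
Proof.
move=> If; have := @integrable_sum _ _ _ mu _ mO _ (index_enum 'I_n) xpredT
  (fun i => EFin \o f i) (fun i _ => If i).
by apply: eq_integrable => // x _; rewrite /= sumEFin.
Qed.

Lemma Rintegral_sum n (f : 'I_n -> 'rV[R]_d -> R) : (forall i, intg (f i)) ->
  \int[mu]_(x in @Omega R d) (\sum_i f i x) = \sum_i \int[mu]_(x in @Omega R d) f i x.
Proof.
elim: n f => [|n IH] f If.
  by rewrite big_ord0; under eq_Rintegral do rewrite big_ord0; rewrite Rintegral_cst// mul0r.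
under eq_Rintegral do rewrite big_ord_recl.
by rewrite RintegralD ?big_ord_recl ?IH//; exact: intg_sum.
Qed.

Lemma intg_bounded f (M : R) : measurable_fun (@Omega R d) f ->
  (forall x, Omega x -> `|f x| <= M) -> intg f.
Proof.
move=> mf fM; apply: (intg_le mf fM).
apply/integrableP; split; first exact: measurable_cst.
rewrite (eq_integral (cst `|M|%:E))// integral_cst//.
by apply: lte_mul_pinfty => //; exact: lebesgue_Omega_lty.
Qed.

Lemma L2M f g : L2 f -> L2 g -> intg (fun x => f x * g x).
Proof.
move=> [mf f2] [mg g2].
apply: (intg_le (g := fun x => f x ^+ 2 + g x ^+ 2)); last exact: intgD.
  exact: measurable_funM.
move=> x _; rewrite ler_norml; have := sqr_ge0 (f x - g x).
by have := sqr_ge0 (f x + g x) => ? ?; apply/andP; split; nra.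
Qed.

Lemma L2D f g : L2 f -> L2 g -> L2 (fun x => f x + g x).
Proof.
move=> Lf Lg; split; first by apply: measurable_funD; [exact: Lf.1|exact: Lg.1].
have := intgD (intgD (L2M Lf Lf) (L2M Lg Lg)) (intgZ 2 (L2M Lf Lg)).
by apply: intg_eq => x _; ring.
Qed.

Lemma L2_mul_bounded f g (M : R) : measurable_fun (@Omega R d) f ->
  (forall x, Omega x -> `|f x| <= M) -> L2 g -> L2 (fun x => f x * g x).
Proof.
move=> mf fM Lg; split; first by apply: measurable_funM => //; exact: Lg.1.
apply: (intg_le (g := fun x => M ^+ 2 * (g x * g x))).
- by apply: measurable_funX; apply: measurable_funM => //; exact: Lg.1.
- move=> x Ox; rewrite ger0_norm ?sqr_ge0// exprMn -expr2.
  apply: ler_wpM2r; first exact: sqr_ge0.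
  rewrite -[leLHS]real_normK ?num_real//; apply: lerXn2r; rewrite ?nnegrE ?normr_ge0 ?fM//.
  exact: le_trans (fM x Ox).
- by apply: intgZ; exact: L2M.
Qed.

Lemma L2Z (c : R) f : L2 f -> L2 (fun x => c * f x).
Proof. by apply: (L2_mul_bounded (f := cst c) (M := `|c|)); first exact: measurable_cst. Qed.

Lemma L2N f : L2 f -> L2 (fun x => - f x).
Proof.
move=> /(L2Z (-1)); rewrite (_ : (fun _ => _) = (fun x => - f x))//.
by apply/funext => x; rewrite mulN1r.
Qed.

Lemma L2B f g : L2 f -> L2 g -> L2 (fun x => f x - g x).
Proof. by move=> Lf /L2N; exact: L2D. Qed.

Lemma L2_bounded f (M : R) : measurable_fun (@Omega R d) f ->
  (forall x, Omega x -> `|f x| <= M) -> L2 f.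
Proof.
move=> mf fM; have L1 : L2 (fun _ : 'rV[R]_d => 1 : R).
  split; first exact: measurable_cst.
  by apply: (@intg_bounded _ 1) => [|x _]; rewrite ?expr1n ?normr1//; exact: measurable_cst.
have := L2_mul_bounded mf fM L1.
by rewrite (_ : (fun _ => _) = f)//; apply/funext => x; rewrite mulr1.
Qed.

Lemma L2_sum n (f : 'I_n -> 'rV[R]_d -> R) :
  (forall i, L2 (f i)) -> L2 (fun x => \sum_i f i x).
Proof.
elim: n f => [|n IH] f Lf.
  apply: (@L2_bounded _ 0) => [|x _]; last by rewrite big_ord0 normr0.
  by under eq_fun do rewrite big_ord0; exact: measurable_cst.
by under eq_fun do rewrite big_ord_recl; apply: L2D => //; exact: IH.
Qed.

Lemma L2_test_function phi : test_function phi -> L2 phi.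
Proof.
move=> tphi; have [M phiM] := test_function_bounded tphi.
exact: (@L2_bounded _ M (test_function_measurable tphi)).
Qed.

Lemma mul_young (p q t : R) : 0 < t -> 2 * `|p * q| <= t * (p * p) + q * q / t.
Proof.
move=> t0; rewrite -[X in X * _](ger0_norm (ler0n _ 2)) -normrM ler_norml.
have sq_ge0 (r : R) : 0 <= r ^+ 2 / t by rewrite divr_ge0 ?sqr_ge0// ltW.
have E1 : t * (p * p) + q * q / t + 2 * (p * q) = (t * p + q) ^+ 2 / t.
  by field; rewrite gt_eqF.
have E2 : t * (p * p) + q * q / t - 2 * (p * q) = (t * p - q) ^+ 2 / t.
  by field; rewrite gt_eqF.
by have := sq_ge0 (t * p + q); have := sq_ge0 (t * p - q); rewrite -E1 -E2;
  move=> ? ?; apply/andP; split; lra.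
Qed.

(** For [A] and [a] nonzero, [t = a / A] gives [2 a <= a + A B / a], that is [a^2 <= A B]. For
    [A = 0], [t = (B + 1) / a] gives [2 a <= a B / (B + 1) <= a], which excludes [a > 0]. *)
Lemma le_sqrt_prod (a A B : R) : 0 <= a -> 0 <= A -> 0 <= B ->
  (forall t, 0 < t -> 2 * a <= t * A + B / t) -> a <= Num.sqrt A * Num.sqrt B.
Proof.
move=> a0 A0 B0 H; rewrite -sqrtrM// -(ger0_norm a0) -sqrtr_sqr; apply: ler_wsqrtr.
have [->|a_neq0] := eqVneq a 0; first by rewrite expr0n/= mulr_ge0.
have {a_neq0}a_gt0 : 0 < a by rewrite lt0r a_neq0.
have [A_eq0|A_neq0] := eqVneq A 0.
  have t0 : 0 < (B + 1) / a by rewrite divr_gt0// ltr_wpDl.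
  have := H _ t0; rewrite A_eq0 mulr0 add0r invf_div mulrA => H1.
  suff : B * a / (B + 1) <= a by nra.
  by rewrite ler_pdivrMr ?ltr_wpDl//; nra.
have t0 : 0 < a / A by rewrite divr_gt0// lt0r A_neq0.
have := H _ t0; rewrite divfK// invf_div mulrA => H1.
by move: H1; rewrite -lerBlDl ler_pdivlMr//; nra.
Qed.

(** The Young bound is integrated for each fixed [t] and optimised only afterwards. Stated for
    densities [A] and [B], it also applies when [f] is a sum of products or is merely dominated by
    such sums. *)
Lemma Rintegral_cauchy_schwarz f A B : intg f -> intg A -> intg B ->
  (forall x, Omega x -> 0 <= A x) -> (forall x, Omega x -> 0 <= B x) ->
  (forall x (t : R), Omega x -> 0 < t -> 2 * `|f x| <= t * A x + B x / t) ->
  `|\int[mu]_(x in @Omega R d) f x| <=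
    Num.sqrt (\int[mu]_(x in @Omega R d) A x) * Num.sqrt (\int[mu]_(x in @Omega R d) B x).
Proof.
move=> If IA IB A0 B0 fAB; apply: le_sqrt_prod => //; try exact: Rintegral_ge0.
move=> t t0; have Inf : intg (fun x => `|f x|).
  by have := integrable_abse If; apply: eq_integrable => // x _.
apply: (@le_trans _ _ (2 * \int[mu]_(x in @Omega R d) `|f x|)).
  by rewrite ler_pM2l//; exact: le_normr_Rintegral.
rewrite [X in _ <= _ + X](_ : _ = \int[mu]_(x in @Omega R d) (t^-1 * B x)); last first.
  by rewrite RintegralZl// mulrC.
rewrite -!RintegralZl// -RintegralD//; try exact: intgZ.
apply: le_Rintegral => //; [exact: intgZ|by apply: intgD; exact: intgZ|].
by move=> x Ox; have := fAB x t Ox t0; rewrite (mulrC (B x)).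
Qed.

Lemma Rintegral_eq0_cvg (f_ : nat -> 'rV[R]_d -> R) f g :
  (forall n, measurable_fun (@Omega R d) (f_ n)) ->
  (forall x, Omega x -> f_ n x @[n --> \oo] --> f x) -> intg g ->
  (forall n x, Omega x -> `|f_ n x| <= g x) ->
  (forall n, \int[mu]_(x in @Omega R d) f_ n x = 0) ->
  \int[mu]_(x in @Omega R d) f x = 0.
Proof.
move=> mf_ f_f Ig f_g f_0.
have mf : measurable_fun (@Omega R d) f by exact: measurable_fun_cvg f_f.
have mE_ n : measurable_fun (@Omega R d) (EFin \o f_ n) by exact/measurable_EFinP.
have mE : measurable_fun (@Omega R d) (EFin \o f) by exact/measurable_EFinP.
have E_E : \forall x \ae mu, Omega x -> (EFin \o f_ n) x @[n --> \oo] --> (EFin \o f) x.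
  by apply: aeW => x Ox; apply: cvg_EFin; [exact: nearW|exact: f_f].
have E_g : \forall x \ae mu, forall n, Omega x -> (`|(EFin \o f_ n) x| <= (EFin \o g) x)%E.
  by apply: aeW => x n Ox; rewrite /= lee_fin; exact: f_g.
have [_ _] := dominated_convergence mO mE_ mE E_E Ig E_g.
rewrite (_ : [sequence _]_n = fun=> 0%E).
  by move/(cvg_lim (@ereal_hausdorff R)); rewrite lim_cst// /Rintegral => <-.
apply/funext => n; have If : intg (f_ n) by exact: intg_le (mf_ n) (f_g n) Ig.
by rewrite -[LHS]fineK; [congr EFin; exact: f_0|exact: integrable_fin_num].
Qed.

End integration.

(** * Integration by parts against a C^1 weight *)

Section integration_by_parts.
Context {R : realType} {d : nat}.
Implicit Types (f g phi u w : 'rV[R]_d -> R).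
Local Notation mu := (lebesgue_rV R d).
Local Notation intg f := (mu.-integrable (@Omega R d) (EFin \o f)).
Let mO := @measurable_Omega R d.

Lemma wpartialP i u : H1 u -> L2 (wpartial i u) /\ is_weak_partial i u (wpartial i u).
Proof. by move=> [_ /(_ i)]; exact: (@xgetPex _ (fun=> 0)). Qed.

Variables (beta : 'rV[R]_d -> R) (M M' : R).
Hypotheses (beta_C1 : Ck 1 beta) (beta_le : forall x, Omega x -> `|beta x| <= M)
  (dbeta_le : forall (i : 'I_d) x, Omega x -> `|partial i beta x| <= M').

Lemma measurable_weight : measurable_fun (@Omega R d) beta.
Proof. by apply: (measurable_bounded_continuous beta_le); exact: Ck_continuous beta_C1. Qed.

Lemma measurable_partial_weight i : measurable_fun (@Omega R d) (partial i beta).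
Proof.
apply: (measurable_bounded_continuous (dbeta_le i)).
by case: beta_C1 => _ /(_ i)[_ []].
Qed.

Lemma weak_partial_weighted_test i w g phi : L2 w -> L2 g -> is_weak_partial i w g ->
  test_function phi ->
  \int[mu]_(x in @Omega R d) (w x * (beta x * partial i phi x + phi x * partial i beta x) +
    g x * (beta x * phi x)) = 0.
Proof.
move=> Lw Lg wg tphi; pose B n := bernstein n beta.
have tdphi := test_function_partial i tphi.
have [P phiP] := test_function_bounded tphi.
have [P' phiP'] := test_function_bounded tdphi.
have Lphi := L2_test_function tphi; have Ldphi := L2_test_function tdphi.
have mB n : measurable_fun (@Omega R d) (B n) by exact: measurable_walk.
have BM n x : Omega x -> `|B n x| <= M by move=> Ox; exact: bernstein_le.
have mdB n : measurable_fun (@Omega R d) (partial i (B n)).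
  rewrite (_ : partial i (B n) = fun x => partial i (B n) x)//.
  under eq_fun do rewrite partial_bernstein.
  by apply: measurable_funM; [exact: measurable_cst|exact: measurable_walk].
have dBM n x : Omega x -> `|partial i (B n) x| <= M'.
  by move=> Ox; apply: partial_bernstein_le => // y; exact: dbeta_le.
have LBphi n : L2 (fun x => B n x * phi x) by exact: L2_mul_bounded (BM n) Lphi.
have LdBphi n : L2 (fun x => B n x * partial i phi x + phi x * partial i (B n) x).
  apply: L2D; first exact: L2_mul_bounded (BM n) Ldphi.
  have := L2_mul_bounded (mdB n) (dBM n) Lphi.
  by rewrite (_ : (fun _ => _) = (fun x => phi x * partial i (B n) x))//;
    apply/funext => x; rewrite mulrC.
pose F n x := w x * (B n x * partial i phi x + phi x * partial i (B n) x) +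
  g x * (B n x * phi x).
have IF1 n : intg (fun x => w x * (B n x * partial i phi x + phi x * partial i (B n) x)).
  exact: L2M.
have IF2 n : intg (fun x => g x * (B n x * phi x)) by exact: L2M.
(* Dominating function, from the bounds on [beta], its gradient, [phi] and its derivative, all of
   which hold uniformly in [n] for the Bernstein polynomials. *)
pose G x := (M * P' + P * M') * `|w x| + M * P * `|g x|.
(* On the cube, of finite measure, square integrability implies integrability: multiply by the
   constant 1. *)
have L1norm f : L2 f -> intg (fun x => `|f x|).
  move=> Lf; have := L2M Lf (@L2_bounded R d (fun=> 1) 1 (@measurable_cst _ _ _ _ _ _) _).
  move=> /(_ (fun x _ => eq_ind_r (fun r => is_true (r <= 1)) (lexx 1) (normr1 _))).
  move=> /(integrable_abse); apply: eq_integrable => // x _.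
  by rewrite /= mulr1.
apply: (@Rintegral_eq0_cvg _ _ F _ G) => [n|x Ox||n x Ox|n].
- by apply: intg_measurable; exact: intgD.
- apply: cvgD; apply: cvgM; try exact: cvg_cst.
    apply: cvgD; apply: cvgM; try exact: cvg_cst.
      exact: cvg_bernstein Ox beta_le (Ck_continuous beta_C1 Ox).
    exact: cvg_partial_bernstein Ox beta_C1 (dbeta_le i).
  apply: cvgM; last exact: cvg_cst.
  exact: cvg_bernstein Ox beta_le (Ck_continuous beta_C1 Ox).
- by apply: intgD; apply: intgZ; exact: L1norm.
- apply: le_trans (ler_normD _ _) _; rewrite !normrM; apply: lerD; last first.
    rewrite mulrC; apply: ler_wpM2r => //; apply: ler_pM => //; exact: BM.
  rewrite mulrC; apply: ler_wpM2r => //; apply: le_trans (ler_normD _ _) _.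
  by rewrite !normrM; apply: lerD; apply: ler_pM => //; [exact: BM|exact: dBM].
- rewrite RintegralD//.
  (* The polynomial [B n] is smooth, so [B n \* phi] is a test function and the definition of the
     weak derivative applies to it. *)
  have := wg _ (test_functionM (fun k => Ck_bernstein k n beta) tphi).
  rewrite (@eq_Rintegral _ _ _ mu _ (fun x => w x * (B n x * partial i phi x + phi x * partial i (B n) x))).
    by move=> ->; rewrite addrC subrr.
  move=> x /set_mem Ox; congr (_ * _).
  exact: (@derive_val _ _ _ _ _ _ _ (is_derive_partialM i (Ck_bernstein 1 n beta) (proj1 tphi 1%N) Ox)).
Qed.

(** The integral is a linear functional of the pair formed by [wpartial i u] and [u], with
    square-integrable coefficients [a] and [c]. It vanishes on test functions and is continuous in
    the H^1 norm, hence vanishes at their limit [u]. *)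
Lemma weak_partial_weighted i w u : H1 w -> H10 u ->
  intg (fun x => w x * (beta x * wpartial i u x + u x * partial i beta x) +
    wpartial i w x * (beta x * u x)) /\
  \int[mu]_(x in @Omega R d) (w x * (beta x * wpartial i u x + u x * partial i beta x) +
    wpartial i w x * (beta x * u x)) = 0.
Proof.
move=> Hw [Hu [phi [tphi phi_u]]].
have [Ldw wdw] := wpartialP i Hw; have [Ldu _] := wpartialP i Hu.
have Lw := Hw.1; have Lu := Hu.1.
pose a x := beta x * w x.
pose c x := partial i beta x * w x + beta x * wpartial i w x.
have La : L2 a by exact: L2_mul_bounded measurable_weight beta_le Lw.
have Lc : L2 c.
  apply: L2D; last exact: L2_mul_bounded measurable_weight beta_le Ldw.
  exact: L2_mul_bounded (@measurable_partial_weight i) (dbeta_le i) Lw.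
pose J g v x := a x * g x + c x * v x.
have JE g v : (fun x => w x * (beta x * g x + v x * partial i beta x) +
    wpartial i w x * (beta x * v x)) = J g v.
  by apply/funext => x; rewrite /J /a /c; ring.
have IJ g v : L2 g -> L2 v -> intg (J g v).
  by move=> Lg Lv; apply: intgD; exact: L2M.
rewrite JE; split; first exact: IJ.
pose A x := a x ^+ 2 + c x ^+ 2.
have IA : intg A by apply: intgD; [case: La|case: Lc].
pose S n := \int[mu]_(x in @Omega R d) (phi n x - u x) ^+ 2 +
  \sum_(i < d) \int[mu]_(x in @Omega R d) (partial i (phi n) x - wpartial i u x) ^+ 2.
have bound n : `|\int[mu]_(x in @Omega R d) J (wpartial i u) u x| <=
    Num.sqrt (\int[mu]_(x in @Omega R d) A x) * Num.sqrt (S n).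
  have Lphi := L2_test_function (tphi n).
  have Ldphi := L2_test_function (test_function_partial i (tphi n)).
  have Lv := L2B Lphi Lu; have Lg := L2B Ldphi Ldu.
  (* By linearity, since the functional is zero on [phi n], its value at [u] is minus its value at
     the approximation error. *)
  have -> : \int[mu]_(x in @Omega R d) J (wpartial i u) u x =
      - \int[mu]_(x in @Omega R d) J (fun x => partial i (phi n) x - wpartial i u x)
          (fun x => phi n x - u x) x.
    have E0 : \int[mu]_(x in @Omega R d) J (partial i (phi n)) (phi n) x = 0.
      have := weak_partial_weighted_test Lw Ldw wdw (tphi n).
      by under eq_Rintegral do rewrite (congr1 (@^~ _) (JE _ _)).
    rewrite -[LHS]subr0 -E0 -RintegralB//; try exact: IJ.
    rewrite -[RHS]mulN1r -RintegralZl//; last exact: IJ.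
    by apply: eq_Rintegral => x _; rewrite /J; ring.
  rewrite normrN.
  pose B x := (partial i (phi n) x - wpartial i u x) ^+ 2 + (phi n x - u x) ^+ 2.
  apply: le_trans (@Rintegral_cauchy_schwarz _ _ _ A B _ _ _ _ _ _) _ => //.
  - exact: IJ.
  - by apply: intgD; [case: Lg|case: Lv].
  - by move=> x _; rewrite addr_ge0 ?sqr_ge0.
  - by move=> x _; rewrite addr_ge0 ?sqr_ge0.
  - move=> x t _ t0; rewrite /J /A /B; set g := _ - _; set v := _ - _.
    have := mul_young (a x) g t0; have := mul_young (c x) v t0.
    have := ler_normD (a x * g) (c x * v); rewrite !expr2 mulrDl mulrDr; lra.
  - rewrite ler_wpM2l ?sqrtr_ge0//; apply: ler_wsqrtr.
    rewrite RintegralD//; [|by case: Lg|by case: Lv].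
    (* [S n] contains the errors of all partial derivatives; those other than the [i]-th are
       nonnegative. *)
    rewrite addrC lerD2l (bigD1 i)//= lerDl; apply: sumr_ge0 => j _.
    by apply: Rintegral_ge0 => x _; exact: sqr_ge0.
apply/eqP; rewrite -normr_le0.
have cvgS : Num.sqrt (\int[mu]_(x in @Omega R d) A x) * Num.sqrt (S n) @[n --> \oo] --> 0.
  rewrite -[X in _ --> X](mulr0 (Num.sqrt (\int[mu]_(x in @Omega R d) A x))).
  apply: cvgMr; rewrite -(@sqrtr0 R).
  exact: (continuous_cvg _ (@sqrt_continuous R 0) phi_u).
set I := `|_| in bound *.
by apply: (ler_cvg_to (@cvg_cst _ I _ \oo _) cvgS); exact: nearW.
Qed.

End integration_by_parts.

(** * Least-squares estimates *)

Section dot_product.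
Context {R : realType}.

Lemma dot_row_mx m n (a c : 'rV[R]_m) (b e : 'rV[R]_n) :
  dot (row_mx a b) (row_mx c e) = dot a c + dot b e.
Proof.
rewrite /dot big_split_ord/=.
by congr (_ + _); apply: eq_bigr => i _; rewrite !(row_mxEl, row_mxEr).
Qed.

Lemma dotZZ n (s t : R) (p q : 'rV[R]_n) : dot (s *: p) (t *: q) = s * t * dot p q.
Proof. by rewrite /dot mulr_sumr; apply: eq_bigr => i _; rewrite !mxE; ring. Qed.

Lemma dotBB n (p q : 'rV[R]_n) :
  dot (p - q) (p - q) = dot p p - 2 * dot p q + dot q q.
Proof.
by rewrite /dot mulr_sumr -sumrB -big_split; apply: eq_bigr => i _; rewrite /= !mxE; ring.
Qed.

Lemma dot_const_mx1 (a b : R) : dot (const_mx a : 'rV_1) (const_mx b) = a * b.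
Proof. by rewrite /dot big_ord1 !mxE. Qed.

Lemma dot_ge0 n (p : 'rV[R]_n) : 0 <= dot p p.
Proof. by apply: sumr_ge0 => i _; exact: sqr_ge0. Qed.

Lemma dot_young n (p q : 'rV[R]_n) (t : R) : 0 < t ->
  2 * `|dot p q| <= t * dot p p + dot q q / t.
Proof.
move=> t0; apply: (@le_trans _ _ (\sum_i 2 * `|p ord0 i * q ord0 i|)).
  by rewrite -mulr_sumr ler_wpM2l// ler_norm_sum.
rewrite /dot mulr_sumr mulr_suml -big_split; apply: ler_sum => i _.
exact: mul_young.
Qed.

End dot_product.

(** * Pointwise bounds on the least-squares integrand, and integrability *)

Section fosls_estimates.
Context {R : realType} {d : nat}.
Local Notation mu := (lebesgue_rV R d).
Local Notation intg f := (mu.-integrable (@Omega R d) (EFin \o f)).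
Variables (eps k b0 b1 : R) (b beta : 'rV[R]_d -> R).
Hypotheses (eps_gt0 : 0 < eps) (b0_gt0 : 0 < b0)
  (mb : measurable_fun (@Omega R d) b) (hb : forall x, Omega x -> b0 < b x < b1)
  (beta_gt0 : forall x, Omega x -> 0 < beta x).
Implicit Types U V : ('rV[R]_d -> R) * ('rV[R]_d -> 'rV[R]_d).

Let mO := @measurable_Omega R d.

Let b_gt0 x : Omega x -> 0 < b x.
Proof. by move=> /hb/andP[+ _]; exact: lt_trans. Qed.

(** Integrand of the squared product norm with the weight [beta] left out, so that both bounds can
    be compared pointwise. *)
Definition norm_density U x : R :=
  U.1 x ^+ 2 + eps * dot (wgrad U.1 x) (wgrad U.1 x) + eps * dot (U.2 x) (U.2 x) +
  eps ^+ 2 * wdiv U.2 x ^+ 2 + eps `^ k * dot (wcurl U.2 x) (wcurl U.2 x).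

Lemma norm_density_ge0 U x : 0 <= norm_density U x.
Proof.
have e0 := ltW eps_gt0.
rewrite /norm_density !addr_ge0// ?sqr_ge0// mulr_ge0 ?dot_ge0 ?sqr_ge0 ?powR_ge0//.
Qed.

Lemma dot_fosls_op U x : Omega x ->
  dot (fosls_op eps k b U x) (fosls_op eps k b U x) =
    eps * (dot (U.2 x) (U.2 x) - 2 * dot (U.2 x) (wgrad U.1 x) +
           dot (wgrad U.1 x) (wgrad U.1 x)) +
    (eps ^+ 2 * wdiv U.2 x ^+ 2 / b x - 2 * eps * (wdiv U.2 x * U.1 x) +
     b x * U.1 x ^+ 2) +
    eps `^ k * dot (wcurl U.2 x) (wcurl U.2 x).
Proof.
case: U => u w /b_gt0 b_gt0'; rewrite /fosls_op !dot_row_mx dot_const_mx1 !dotZZ dotBB.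
rewrite -expr2 sqr_sqrtr ?ltW//.
have -> : eps `^ (k / 2) * eps `^ (k / 2) = eps `^ k.
  by rewrite -powRD -?splitr// (gt_eqF eps_gt0) implybT.
rewrite -[RHS]addrA; congr (_ + (_ + _)).
rewrite -[in RHS](sqr_sqrtr (ltW b_gt0')) /=; field.
by rewrite gt_eqF// sqrtr_gt0.
Qed.

(** Each squared difference is at most twice the sum of the squares. The coefficients are then 2 in
    the first row, [2 * m] in the second, where [m] bounds both [b x] and its inverse, and 1 for the
    curl; all are below [3 + 2 * m]. *)
Lemma dot_fosls_op_le U x : Omega x ->
  dot (fosls_op eps k b U x) (fosls_op eps k b U x) <=
  (3 + 2 * Num.max b0^-1 b1) * norm_density U x.
Proof.
move=> Ox; rewrite dot_fosls_op// /norm_density.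
have bx := b_gt0 Ox; have /andP[b0x b1x] := hb Ox.
set m := Num.max _ _.
have m_b1 : b x <= m by rewrite le_max (ltW b1x) orbT.
have m_b0 : (b x)^-1 <= m by rewrite le_max lef_pV2 ?posrE// (ltW b0x).
have m0 : 0 <= m by apply: le_trans m_b1; exact: ltW.
set u := U.1 x; set D := wdiv _ _.
set ww := dot (U.2 x) (U.2 x); set wg := dot (U.2 x) _; set gg := dot (wgrad _ _) _.
set cc := _ * dot (wcurl _ _) _.
have cc0 : 0 <= cc by rewrite mulr_ge0 ?powR_ge0 ?dot_ge0.
have ww0 : 0 <= eps * ww by rewrite mulr_ge0 ?dot_ge0// ltW.
have gg0 : 0 <= eps * gg by rewrite mulr_ge0 ?dot_ge0// ltW.
have H1 : eps * (- (2 * wg)) <= eps * (ww + gg).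
  rewrite ler_pM2l//; have := dot_young (U.2 x) (wgrad U.1 x) (@ltr01 R).
  rewrite -/wg -/ww -/gg mul1r divr1 => H; have := ler_norm (- wg); rewrite normrN; lra.
have H2 : - (2 * eps * (D * u)) <= eps ^+ 2 * D ^+ 2 / b x + b x * u ^+ 2.
  have : 0 <= b x * (eps * D / b x + u) ^+ 2 by rewrite mulr_ge0 ?sqr_ge0// ltW.
  rewrite (_ : b x * _ = eps ^+ 2 * D ^+ 2 / b x + 2 * eps * (D * u) + b x * u ^+ 2).
    by lra.
  by field; rewrite gt_eqF.
have H3 : eps ^+ 2 * D ^+ 2 / b x <= eps ^+ 2 * D ^+ 2 * m.
  by rewrite ler_wpM2l// mulr_ge0 ?sqr_ge0.
have H4 : b x * u ^+ 2 <= m * u ^+ 2 by rewrite ler_wpM2r ?sqr_ge0.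
have DD0 : 0 <= eps ^+ 2 * D ^+ 2 by rewrite mulr_ge0 ?sqr_ge0.
have uu0 := sqr_ge0 u.
have := mulr_ge0 m0 cc0; have := mulr_ge0 m0 ww0; have := mulr_ge0 m0 gg0.
rewrite !mulrDr !mulrDl; lra.
Qed.

(** With [grad] the gradient of [beta], the added term is [2 * eps] times the divergence of
    [beta u w], whose integral will vanish. It cancels the two cross terms of the expanded square
    and leaves only [2 eps u (w . grad)]. *)
Lemma dot_fosls_op_ge (C : R) U x (grad : 'rV[R]_d) : 0 < C -> Omega x ->
  dot grad grad < b0 * beta x ^+ 2 / (eps * (1 + C) ^+ 2) ->
  Num.min (Num.min (C * Num.min 1 b0 / (1 + C)) b1^-1) 1 * (beta x * norm_density U x) <=
  beta x * dot (fosls_op eps k b U x) (fosls_op eps k b U x) +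
  2 * eps * (beta x * dot (U.2 x) (wgrad U.1 x) + U.1 x * dot (U.2 x) grad +
             beta x * (wdiv U.2 x * U.1 x)).
Proof.
move=> C0 Ox hgrad; rewrite dot_fosls_op// /norm_density.
have bx := b_gt0 Ox; have /andP[b0x b1x] := hb Ox; have betax := beta_gt0 Ox.
have C1 : 0 < 1 + C by rewrite addr_gt0.
set m := Num.min _ _.
set u := U.1 x; set D := wdiv _ _.
set ww := dot (U.2 x) (U.2 x); set wg := dot (U.2 x) (wgrad _ _).
set gg := dot (wgrad _ _) _; set cc := _ * dot (wcurl _ _) _; set wb := dot (U.2 x) grad.
have cc0 : 0 <= cc by rewrite mulr_ge0 ?powR_ge0 ?dot_ge0.
have ww0 : 0 <= eps * ww by rewrite mulr_ge0 ?dot_ge0// ltW.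
have gg0 : 0 <= eps * gg by rewrite mulr_ge0 ?dot_ge0// ltW.
have DD0 : 0 <= eps ^+ 2 * D ^+ 2 by rewrite mulr_ge0 ?sqr_ge0.
have uu0 := sqr_ge0 u.
(* The minimum lies below each of the four coefficients that survive: [1], [(b x)^-1], [C / (1 + C)]
   and [C * b0 / (1 + C)]. *)
have m1 : m <= 1 by rewrite ge_min lexx orbT.
have mb1 : m <= (b x)^-1.
  apply: (@le_trans _ _ b1^-1); first by rewrite !ge_min lexx !orbT.
  by rewrite lef_pV2 ?posrE ?ltW// (lt_trans bx).
have mC : m <= C / (1 + C).
  apply: (@le_trans _ _ (C * Num.min 1 b0 / (1 + C))); first by rewrite !ge_min lexx.
  rewrite ler_pM2r ?invr_gt0// -[leRHS]mulr1 ler_pM2l//.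
  by rewrite ge_min lexx.
have mCb : m <= C * b0 / (1 + C).
  apply: (@le_trans _ _ (C * Num.min 1 b0 / (1 + C))); first by rewrite !ge_min lexx.
  by rewrite ler_pM2r ?invr_gt0// ler_pM2l// ge_min lexx orbT.
have cross : - (2 * eps * (u * wb)) <=
    beta x * ((eps * ww) / (1 + C) + b0 / (1 + C) * u ^+ 2).
  (* With this Young parameter the bound on [grad] costs exactly a fraction [1 / (1 + C)] of both
     [eps * ww] and [b0 * u ^+ 2], leaving [C / (1 + C)] of each. *)
  have t0 : 0 < beta x / (1 + C) by rewrite divr_gt0.
  have := dot_young (1 *: U.2 x) (u *: grad) t0; rewrite !dotZZ mul1r -/wb !mul1r -/ww.
  move=> H; have {}H : - (2 * (u * wb)) <=
      beta x / (1 + C) * ww + u * u * dot grad grad / (beta x / (1 + C)).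
    by have := ler_norm (- (u * wb)); rewrite normrN; lra.
  have H' : u * u * dot grad grad / (beta x / (1 + C)) <=
      u ^+ 2 * (b0 * beta x / (eps * (1 + C))).
    rewrite -expr2 -mulrA ler_wpM2l//.
    rewrite ler_pdivrMr//; apply: le_trans (ltW hgrad) _.
    by rewrite le_eqVlt; apply/orP; left; apply/eqP; field; rewrite !gt_eqF.
  have := ler_wpM2l (ltW eps_gt0) (le_trans H (lerD (lexx _) H')).
  rewrite (_ : eps * - _ = - (2 * eps * (u * wb))); last by ring.
  move/le_trans; apply.
  by rewrite le_eqVlt; apply/orP; left; apply/eqP; field; rewrite !gt_eqF.
have I1 : m * u ^+ 2 <= C * b0 / (1 + C) * u ^+ 2 by rewrite ler_wpM2r.
have I2 : m * (eps * gg) <= eps * gg by rewrite ler_piMl.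
have I3 : m * (eps * ww) <= C / (1 + C) * (eps * ww) by rewrite ler_wpM2r.
have I4 : m * (eps ^+ 2 * D ^+ 2) <= (b x)^-1 * (eps ^+ 2 * D ^+ 2) by rewrite ler_wpM2r.
have I5 : m * cc <= cc by rewrite ler_piMl.
have I6 : b0 * u ^+ 2 <= b x * u ^+ 2 by rewrite ler_wpM2r// ltW.
have E1 : C / (1 + C) = 1 - (1 + C)^-1 by field; rewrite gt_eqF.
have E2 : C * b0 / (1 + C) = b0 - b0 / (1 + C) by field; rewrite gt_eqF.
have I : m * (u ^+ 2 + eps * gg + eps * ww + eps ^+ 2 * D ^+ 2 + cc) <=
    eps * ww - eps * ww / (1 + C) + eps * gg + eps ^+ 2 * D ^+ 2 / b x +
    (b x * u ^+ 2 - b0 / (1 + C) * u ^+ 2) + cc.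
  move: I1 I3; rewrite E1 E2 => I1 I3.
  rewrite !mulrDr; lra.
have := ler_wpM2l (ltW betax) I; rewrite (mulrCA m) => {}I.
apply: le_trans I _.
rewrite -subr_ge0; move: cross; rewrite -subr_ge0 => cross.
rewrite [leRHS](_ : _ = beta x * (eps * ww / (1 + C) + b0 / (1 + C) * u ^+ 2) -
  - (2 * eps * (u * wb)))//.
by field; rewrite !gt_eqF.
Qed.

Variable M : R.
Hypotheses (mbeta : measurable_fun (@Omega R d) beta)
  (beta_le : forall x, Omega x -> `|beta x| <= M).

Lemma intg_weight f : intg f -> intg (fun x => beta x * f x).
Proof.
move=> If; have mf := intg_measurable If.
apply: (intg_le (g := fun x => M * `|f x|)).
- exact: measurable_funM.
- by move=> x Ox; rewrite normrM ler_wpM2r// beta_le.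
- by apply: intgZ; apply: eq_integrable (integrable_abse If).
Qed.

Lemma intg_dot n (p q : 'rV[R]_d -> 'rV[R]_n) :
  (forall i, L2 (fun x => p x ord0 i)) -> (forall i, L2 (fun x => q x ord0 i)) ->
  intg (fun x => dot (p x) (q x)).
Proof. by move=> Lp Lq; apply: intg_sum => i; exact: L2M. Qed.

Lemma L2_wgrad (u : 'rV[R]_d -> R) i : H1 u -> L2 (fun x => wgrad u x ord0 i).
Proof. by move=> /(wpartialP i)[L _]; under eq_fun do rewrite mxE. Qed.

Lemma L2_wdiv (w : 'rV[R]_d -> 'rV[R]_d) : H1_vec w -> L2 (wdiv w).
Proof. by move=> Hw; apply: L2_sum => i; exact: (wpartialP i (Hw i)).1. Qed.

Lemma L2_fosls_op U i : in_H1_product U -> (forall i, L2 (fun x => wcurl U.2 x ord0 i)) ->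
  L2 (fun x => fosls_op eps k b U x ord0 i).
Proof.
case: U => u w [/= Hu Hw] Lc.
have msqrt : measurable_fun (@Omega R d) (fun x => Num.sqrt (b x)).
  by apply: measurableT_comp => //; apply: continuous_measurable_fun; exact: sqrt_continuous.
have sqrt_b1 x : Omega x -> `|Num.sqrt (b x)| <= Num.sqrt b1.
  move=> Ox; rewrite ger0_norm ?sqrtr_ge0//; apply: ler_wsqrtr.
  by have /andP[_ /ltW] := hb Ox.
have sqrtV_b0 x : Omega x -> `|(Num.sqrt (b x))^-1| <= (Num.sqrt b0)^-1.
  move=> Ox; rewrite ger0_norm ?invr_ge0 ?sqrtr_ge0// lef_pV2 ?posrE ?sqrtr_gt0 ?b_gt0//.
  by apply: ler_wsqrtr; have /andP[/ltW] := hb Ox.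
have msqrtV : measurable_fun (@Omega R d) (fun x => (Num.sqrt (b x))^-1).
  (* On the cube the root is positive, so its inverse is a composition of the measurable functions
     [expR], opposite and [ln]. *)
  apply: (@eq_measurable_fun _ _ _ _ _ (fun x => expR (- ln (Num.sqrt (b x))))).
    move=> x /set_mem Ox; rewrite expRN lnK// posrE sqrtr_gt0; exact: b_gt0.
  apply: measurableT_comp => //; apply: measurableT_comp => //.
  exact: measurableT_comp.
rewrite /fosls_op; under eq_fun do rewrite mxE.
case: (fintype.split i) => [j|j].
  under eq_fun do rewrite !mxE.
  apply: L2Z; apply: L2B; first exact: (Hw j).1.
  exact: (wpartialP j Hu).1.
under eq_fun do rewrite mxE.
case: (fintype.split j) => [l|l]; last by under eq_fun do rewrite mxE; exact: L2Z.
under eq_fun do rewrite mxE -mulrA.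
apply: L2D; last exact: L2_mul_bounded msqrt sqrt_b1 Hu.1.
by apply: L2Z; exact: L2_mul_bounded msqrtV sqrtV_b0 (L2_wdiv Hw).
Qed.

Lemma intg_norm_density U : in_H1_product U -> (forall i, L2 (fun x => wcurl U.2 x ord0 i)) ->
  intg (fun x => beta x * norm_density U x).
Proof.
move=> [Hu Hw] Lc; apply: intg_weight.
have Ig := intg_dot (fun i => L2_wgrad i Hu) (fun i => L2_wgrad i Hu).
have Iw := intg_dot (fun i => (Hw i).1) (fun i => (Hw i).1).
have Ic := intg_dot Lc Lc.
rewrite /norm_density; apply: intgD; last exact: intgZ.
apply: intgD; last by apply: intgZ; exact: (L2_wdiv Hw).2.
apply: intgD; last exact: intgZ.
by apply: intgD; [exact: Hu.1.2|exact: intgZ].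
Qed.

(** Positivity of [beta] makes every weighted integral of a square nonnegative, so squaring the
    individual norms undoes their roots and the integrals add up. *)
Lemma product_normE U : in_H1_product U -> (forall i, L2 (fun x => wcurl U.2 x ord0 i)) ->
  product_norm eps k beta U =
  Num.sqrt (\int[mu]_(x in @Omega R d) (beta x * norm_density U x)).
Proof.
move=> HU Lc; move: (HU) => [Hu Hw].
have Ig := intg_weight (intg_dot (fun i => L2_wgrad i Hu) (fun i => L2_wgrad i Hu)).
have Iw := intg_weight (intg_dot (fun i => (Hw i).1) (fun i => (Hw i).1)).
have Ic := intg_weight (intg_dot Lc Lc).
have Iu := intg_weight Hu.1.2.
have Id := intg_weight (L2_wdiv Hw).2.
have dot0 n (p : 'rV[R]_d -> 'rV[R]_n) :
    0 <= \int[mu]_(x in @Omega R d) (beta x * dot (p x) (p x)).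
  by apply: Rintegral_ge0 => x Ox; rewrite mulr_ge0 ?dot_ge0// ltW ?beta_gt0.
have sq0 (f : 'rV[R]_d -> R) :
    0 <= \int[mu]_(x in @Omega R d) (beta x * f x * f x).
  by apply: Rintegral_ge0 => x Ox; rewrite -mulrA mulr_ge0 -?expr2 ?sqr_ge0// ltW ?beta_gt0.
have sqE (f : 'rV[R]_d -> R) : \int[mu]_(x in @Omega R d) (beta x * f x * f x) =
    \int[mu]_(x in @Omega R d) (beta x * f x ^+ 2).
  by apply: eq_Rintegral => x _; rewrite -mulrA.
case: U HU Lc Hu Hw Ig Iw Ic Iu Id => u w /= _ _ Hu Hw Ig Iw Ic Iu Id.
rewrite /product_norm /wnorm /wnorm_vec /winner /winner_vec !sqr_sqrtr// !sqE.
rewrite -!RintegralZl// -!RintegralD//; try by repeat (apply: intgD); repeat (apply: intgZ).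
by congr Num.sqrt; apply: eq_Rintegral => x _; rewrite /norm_density/=; ring.
Qed.

End fosls_estimates.

(** The shape of the curl depends on [d]: in dimensions 2 and 3 each component is a difference of
    weak derivatives, otherwise there is no index. *)
Lemma L2_wcurl (R : realType) (d : nat) (w : 'rV[R]_d -> 'rV[R]_d) : H1_vec w ->
  forall i, L2 (fun x => wcurl w x ord0 i).
Proof.
case: d w => [|[|[|[|d]]]] w Hw /= i; try by case: i.
- by under eq_fun do rewrite mxE; apply: L2B; exact: (wpartialP _ (Hw _)).1.
- by under eq_fun do rewrite mxE; apply: L2B; exact: (wpartialP _ (Hw _)).1.
Qed.

(** * Continuity and coercivity of the weighted form, by integrating the pointwise bounds *)

Theorem theorem1 (R : realType) (d : nat) (hd : (1 <= d <= 3)%N)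
    (eps : R) (heps : 0 < eps)
    (b : 'rV[R]_d -> R) (mb : measurable_fun (@Omega R d) b)
    (b0 b1 : R) (hb0 : 0 < b0)
    (hb : forall x, Omega x -> b0 < b x < b1)
    (beta : 'rV[R]_d -> R) (beta_C1 : Ck 1 beta)
    (beta_gt0 : forall x, Omega x -> 0 < beta x)
    (C : R) (hC : 0 < C)
    (hbeta : forall x, Omega x ->
       dot (gradient beta x) (gradient beta x) <
       b0 * beta x ^+ 2 / (eps * (1 + C) ^+ 2))
    (k : R) :
  (forall U V : ('rV[R]_d -> R) * ('rV[R]_d -> 'rV[R]_d),
     in_H1_product U -> in_H1_product V ->
     `|fosls_form eps k b beta U V| <=
     (3 + 2 * Num.max b0^-1 b1) *
       product_norm eps k beta U * product_norm eps k beta V) /\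
  (forall U : ('rV[R]_d -> R) * ('rV[R]_d -> 'rV[R]_d),
     in_H1_product U -> H10 U.1 ->
     Num.min (Num.min (C * Num.min 1 b0 / (1 + C)) b1^-1) 1 *
       product_norm eps k beta U ^+ 2 <=
     fosls_form eps k b beta U U).
Proof.
have mO := @measurable_Omega R d.
(* The gradient hypothesis says that the length of the gradient of [beta] is below [K * beta], so
   [K] bounds the logarithmic gradient. *)
pose K := Num.sqrt (b0 / (eps * (1 + C) ^+ 2)).
have K0 : 0 <= K by exact: sqrtr_ge0.
have q0 : 0 <= b0 / (eps * (1 + C) ^+ 2).
  by apply: divr_ge0; [exact: ltW|apply: mulr_ge0; [exact: ltW|exact: sqr_ge0]].
have dbeta i x : Omega x -> `|partial i beta x| <= K * beta x.
  move=> Ox; rewrite -[K * _]ger0_norm; last by rewrite mulr_ge0// ltW ?beta_gt0.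
  rewrite -ler_sqr ?nnegrE ?normr_ge0// !real_normK ?num_real// exprMn sqr_sqrtr//.
  rewrite mulrAC; apply: le_trans (ltW (hbeta x Ox)).
  rewrite /dot (bigD1 i)//= !mxE -expr2 lerDl; apply: sumr_ge0 => j _.
  exact: sqr_ge0.
have [M betaM] := weight_bounded beta_C1 beta_gt0 K0 dbeta.
have beta_le x : Omega x -> `|beta x| <= M.
  by move=> Ox; rewrite gtr0_norm ?betaM// beta_gt0.
have dbeta_le (i : 'I_d) x : Omega x -> `|partial i beta x| <= K * M.
  by move=> Ox; apply: le_trans (dbeta i x Ox) _; rewrite ler_wpM2l// betaM.
have mbeta := measurable_weight beta_C1 beta_le.
set c := 3 + _; have c0 : 0 <= c.
  by rewrite /c addr_ge0// mulr_ge0// le_max invr_ge0 (ltW hb0).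
have IL U V : in_H1_product U -> in_H1_product V ->
    (lebesgue_rV R d).-integrable (@Omega R d)
     (EFin \o (fun x => beta x * dot (fosls_op eps k b U x) (fosls_op eps k b V x))).
  move=> HU HV; apply: (intg_weight mbeta beta_le); apply: intg_dot => i.
    exact: (L2_fosls_op _ _ hb0 mb hb _ HU (L2_wcurl HU.2)).
  exact: (L2_fosls_op _ _ hb0 mb hb _ HV (L2_wcurl HV.2)).
have IN U : in_H1_product U -> (lebesgue_rV R d).-integrable (@Omega R d)
    (EFin \o (fun x => beta x * norm_density eps k U x)).
  by move=> HU; exact: (intg_norm_density _ _ mbeta beta_le HU (L2_wcurl HU.2)).
have N0 U x : Omega x -> 0 <= beta x * norm_density eps k U x.
  by move=> Ox; rewrite mulr_ge0 ?norm_density_ge0// ltW ?beta_gt0.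
have normE U : in_H1_product U -> product_norm eps k beta U =
    Num.sqrt (\int[lebesgue_rV R d]_(x in @Omega R d) (beta x * norm_density eps k U x)).
  by move=> HU; exact: (product_normE _ _ beta_gt0 mbeta beta_le HU (L2_wcurl HU.2)).
split=> [U V HU HV|U HU H0].
  rewrite /fosls_form /winner_vec !normE//.
  (* The constant [c] is put into both densities; the two factors [Num.sqrt c] then combine to a
     single [c]. *)
  apply: le_trans (Rintegral_cauchy_schwarz
    (A := fun x => c * (beta x * norm_density eps k U x))
    (B := fun x => c * (beta x * norm_density eps k V x)) (IL _ _ HU HV) _ _ _ _ _) _.
  - by apply: intgZ; exact: IN.
  - by apply: intgZ; exact: IN.
  - by move=> x Ox; rewrite mulr_ge0// N0.
  - by move=> x Ox; rewrite mulr_ge0// N0.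
  - move=> x t Ox t0; have bx := beta_gt0 x Ox.
    rewrite normrM (gtr0_norm bx) mulrCA.
    apply: (@le_trans _ _ (beta x * (t * (c * norm_density eps k U x) +
        c * norm_density eps k V x / t))); last first.
      by rewrite le_eqVlt; apply/orP; left; apply/eqP; field; rewrite gt_eqF.
    rewrite ler_pM2l//; apply: le_trans (dot_young _ _ t0) _.
    have HUx := dot_fosls_op_le k heps hb0 hb U Ox.
    have HVx := dot_fosls_op_le k heps hb0 hb V Ox.
    by apply: lerD; [rewrite ler_pM2l|rewrite ler_pM2r ?invr_gt0].
  - rewrite !RintegralZl ?IN// !(sqrtrM _ c0) mulrACA -expr2 sqr_sqrtr//.
    by rewrite mulrA.
rewrite normE// sqr_sqrtr; last by apply: Rintegral_ge0 => x; exact: N0.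
set m := Num.min _ _; rewrite /fosls_form /winner_vec.
(* This is the expansion of the [i]-th derivative of [beta u w_i]; its integral is zero because [u]
   belongs to H^1_0. *)
pose J i x := component i U.2 x * (beta x * wpartial i U.1 x + U.1 x * partial i beta x) +
  wpartial i (component i U.2) x * (beta x * U.1 x).
have IJ i := (weak_partial_weighted beta_C1 beta_le dbeta_le i (HU.2 i) H0).1.
have J0 i := (weak_partial_weighted beta_C1 beta_le dbeta_le i (HU.2 i) H0).2.
have ISJ := intg_sum IJ.
(* Adding a term of zero integral leaves the form unchanged and makes its integrand satisfy the
   pointwise lower bound. *)
have -> : \int[lebesgue_rV R d]_(x in @Omega R d)
     (beta x * dot (fosls_op eps k b U x) (fosls_op eps k b U x)) =
   \int[lebesgue_rV R d]_(x in @Omega R d)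
     (beta x * dot (fosls_op eps k b U x) (fosls_op eps k b U x) +
      2 * eps * \sum_i J i x).
  rewrite RintegralD//; [|exact: IL|exact: intgZ].
  rewrite RintegralZl// Rintegral_sum// big1 ?mulr0 ?addr0// => i _.
  exact: J0.
rewrite -RintegralZl ?IN//; apply: le_Rintegral => //.
- by apply: intgZ; exact: IN.
- by apply: intgD; [exact: IL|exact: intgZ].
move=> x Ox.
apply: le_trans (dot_fosls_op_ge k heps hb0 hb beta_gt0 U hC Ox (hbeta x Ox)) _.
rewrite le_eqVlt; apply/orP; left; apply/eqP; congr (_ + _ * _).
rewrite /dot /wdiv mulr_suml !mulr_sumr -!big_split; apply: eq_bigr => i _.
by rewrite /J /component !mxE/=; ring.
Qed.
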